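(* Let $E$ be a semiprimary ring, let $\Lambda\subset E$ be a subring, and let $M$ be a right $E$-module, regarded also as a right $\Lambda$-module $M_\Lambda$ by restriction of scalars along the inclusion $\Lambda\subset E$. Then $M_\Lambda$ is Noetherian if and only if $M_\Lambda$ is Artinian.
   Context: Rings are associative with identity (not necessarily commutative), subrings contain the identity of the larger ring, and modules are unital. For a ring $R$, $\operatorname{rad}(R)$ denotes its Jacobson radical. A ring $R$ is called semilocal if $R/\operatorname{rad}(R)$ is a semisimple ring, and semiprimary if it is semilocal and moreover $\operatorname{rad}(R)$ is nilpotent (i.e. $\operatorname{rad}(R)^n=0$ for some $n\geq 1$). A module is Noetherian (respectively Artinian) if its submodules satisfy the ascending (respectively descending) chain condition. *)

(* Defs.v *)
From HB Require Import structures.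
From mathcomp Require Import all_boot all_order all_algebra.
From mathcomp Require Import all_classical.

Set Implicit Arguments.
Unset Strict Implicit.
Unset Printing Implicit Defensive.

Import GRing.Theory.
Local Open Scope ring_scope.
Local Open Scope quotient_scope.
Local Open Scope classical_set_scope.

(* The zero ring is allowed. A right R-module is a left module
   over the converse ring, i.e. an [lmodType R^c]: [a *: m] stands for m.a,
   and the scaling law reads a *: (b *: m) = (b * a) *: m in R. *)

Definition submodule (R : pzRingType) (V : lmodType R) (N : set V) : Prop :=
  submod_closed [in N].

Definition noetherian (R : pzRingType) (V : lmodType R) : Prop :=
  forall N : nat -> set V,
    (forall i, submodule (N i)) -> (forall i, N i `<=` N i.+1) ->
  exists n, forall m, (n <= m)%N -> N m = N n.

Definition artinian (R : pzRingType) (V : lmodType R) : Prop :=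
  forall N : nat -> set V,
    (forall i, submodule (N i)) -> (forall i, N i.+1 `<=` N i) ->
  exists n, forall m, (n <= m)%N -> N m = N n.

Definition maximal_submodule (R : pzRingType) (V : lmodType R) (N : set V) :
    Prop :=
  [/\ submodule N, N <> setT &
      forall P : set V, submodule P -> N `<=` P -> P = N \/ P = setT].

Definition semisimple_module (R : pzRingType) (V : lmodType R) : Prop :=
  forall N : set V, submodule N ->
  exists P : set V, [/\ submodule P, N `&` P = [set 0] &
    [set x + y | x in N & y in P] = setT].

(* R as a right module over itself; its submodules are the right ideals. *)
Notation right_regular R := ((R^c)^o).

Definition semisimple_ring (R : pzRingType) : Prop :=
  semisimple_module (right_regular R).

(* Jacobson radical: the intersection of the maximal right ideals. *)
Definition rad (R : pzRingType) : set R :=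
  \bigcap_(m in @maximal_submodule _ (right_regular R)) (m : set R).
Arguments rad : clear implicits.

Section RadicalIdeal.
Context (R : pzRingType).
Implicit Types (m : set R) (x y z : R).

Lemma right_idealP m :
  @submodule _ (right_regular R) m <->
  [/\ m 0, forall x y, m x -> m y -> m (x + y) & forall x z, m x -> m (x * z)].
Proof.
split=> [[m0 ml]|[m0 mD mM]].
  have mM x z : m x -> m (x * z).
    move=> mx; have := ml z x 0; rewrite addr0 !inE; apply=> //.
    by move: m0; rewrite inE.
  split=> // [|x y mx my]; first by move: m0; rewrite inE.
  by have := ml 1 x y; rewrite scale1r !inE; apply.
split; first by rewrite inE.
by move=> a u v; rewrite !inE => mu mv; apply: mD => //; apply: mM.
Qed.

Lemma rad0 : rad R 0.
Proof. by move=> m [/right_idealP[]]. Qed.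

Lemma radD x y : rad R x -> rad R y -> rad R (x + y).
Proof.
move=> rx ry m mm; have [/right_idealP[_ mD _] _ _] := mm.
by apply: mD; [apply: rx|apply: ry].
Qed.

Lemma radMr x z : rad R x -> rad R (x * z).
Proof.
move=> rx m mm; have [/right_idealP[_ _ mM] _ _] := mm.
by apply: mM; apply: rx.
Qed.

Lemma radN x : rad R x -> rad R (- x).
Proof. by move=> rx; rewrite -mulrN1; apply: radMr. Qed.

Lemma radMl z x : rad R x -> rad R (z * x).
Proof.
move=> rx m mm; have [/right_idealP[m0 mD mM] mT mmax] := mm.
have [mz|mz] := pselect (m z); first exact: mM.
apply: (rx [set y | m (z * y)]); split.
- apply/right_idealP; split=> /= [|u v mu mv|u v mu]; first by rewrite mulr0.
    by rewrite mulrDr; apply: mD.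
  by rewrite mulrA; apply: mM.
- by move=> E; apply: mz; have : setT (1 : R) by []; rewrite -E /= mulr1.
move=> P sP mP; have /right_idealP[P0 PD PM] := sP.
have [PE|] := pselect (P `<=` [set y | m (z * y)]).
  by left; apply/seteqP.
move=> /existsNP[p /not_implyP[Pp mzp]]; right.
pose Q : set R := [set u | exists v w : R, m v /\ u = v + z * p * w].
have sQ : @submodule _ (right_regular R) Q.
  apply/right_idealP; split.
  - by exists 0, 0; rewrite mulr0 addr0.
  - move=> _ _ [v [w [mv ->]]] [v' [w' [mv' ->]]].
    by exists (v + v'), (w + w'); rewrite mulrDr addrACA; split=> //; apply: mD.
  - move=> _ u [v [w [mv ->]]]; exists (v * u), (w * u).
    by rewrite mulrDl !mulrA; split=> //; apply: mM.
have mQ : m `<=` Q by move=> v mv; exists v, 0; rewrite mulr0 addr0.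
have [QE|QT] := mmax Q sQ mQ.
  case: mzp; rewrite /= -QE.
  by exists 0, 1; rewrite mulr1 add0r.
have [v [w [mv zE]]] : Q z by rewrite QT.
have P1 : P (1 : R).
  rewrite -[1 : R](subrK ((p : R) * w)); apply: PD; last exact: PM.
  apply: mP; rewrite /= mulrBr mulr1 mulrA.
  by rewrite [X in m (X - _)]zE addrK.
apply/seteqP; split=> // u _.
by have := PM _ (u : R) P1; rewrite mul1r.
Qed.

Definition rad_equiv x y : bool := x - y \in rad R.

Lemma rad_equiv_refl : reflexive rad_equiv.
Proof. by move=> x; rewrite /rad_equiv subrr inE; apply: rad0. Qed.

Lemma rad_equiv_sym : symmetric rad_equiv.
Proof.
move=> x y; rewrite /rad_equiv; apply/idP/idP; rewrite !inE => /radN;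
by rewrite opprB.
Qed.

Lemma rad_equiv_trans : transitive rad_equiv.
Proof.
move=> y x z; rewrite /rad_equiv !inE => xy yz.
by rewrite -(subrK y x) -addrA; apply: radD.
Qed.

Canonical rad_equiv_rel :=
  EquivRel rad_equiv rad_equiv_refl rad_equiv_sym rad_equiv_trans.

(* The quotient ring R / rad(R). *)
Definition rad_quot := {eq_quot rad_equiv}.

HB.instance Definition _ : EqQuotient R rad_equiv rad_quot :=
  EqQuotient.on rad_quot.
HB.instance Definition _ := Choice.on rad_quot.

Lemma rad_quotP x y : reflect (rad R (x - y)) (x == y %[mod rad_quot]).
Proof. by rewrite piE; apply: (iffP idP); rewrite /= /rad_equiv inE. Qed.

Lemma rad_repr x : rad R (x - repr (\pi_rad_quot x)).
Proof. by apply/rad_quotP; rewrite reprK. Qed.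

Definition rad_quot_zero : rad_quot := lift_cst rad_quot 0.
Definition rad_quot_one : rad_quot := lift_cst rad_quot 1.
Definition rad_quot_opp := lift_op1 rad_quot -%R.
Definition rad_quot_add := lift_op2 rad_quot +%R.
Definition rad_quot_mul := lift_op2 rad_quot *%R.

Canonical pi_rad_zero := PiConst rad_quot_zero.
Canonical pi_rad_one := PiConst rad_quot_one.

Lemma pi_rad_opp_subproof : {morph \pi_rad_quot : x / - x >-> rad_quot_opp x}.
Proof.
move=> x; unlock rad_quot_opp; apply/eqP/rad_quotP.
by rewrite -opprD; apply: radN; apply: rad_repr.
Qed.
Canonical pi_rad_opp := PiMorph1 pi_rad_opp_subproof.

Lemma pi_rad_add_subproof :
  {morph \pi_rad_quot : x y / x + y >-> rad_quot_add x y}.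
Proof.
move=> x y; unlock rad_quot_add; apply/eqP/rad_quotP.
by rewrite opprD addrACA; apply: radD; apply: rad_repr.
Qed.
Canonical pi_rad_add := PiMorph2 pi_rad_add_subproof.

Lemma pi_rad_mul_subproof :
  {morph \pi_rad_quot : x y / x * y >-> rad_quot_mul x y}.
Proof.
move=> x y; unlock rad_quot_mul; apply/eqP/rad_quotP.
set x' := repr _; set y' := repr _.
rewrite -(subrK (x' * y) (x * y)) -mulrBl -addrA -mulrBr.
by apply: radD; [apply: radMr|apply: radMl]; apply: rad_repr.
Qed.
Canonical pi_rad_mul := PiMorph2 pi_rad_mul_subproof.

Lemma rad_quot_addA : associative rad_quot_add.
Proof. by elim/quotW=> x; elim/quotW=> y; elim/quotW=> z; rewrite !piE addrA. Qed.
Lemma rad_quot_addC : commutative rad_quot_add.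
Proof. by elim/quotW=> x; elim/quotW=> y; rewrite !piE addrC. Qed.
Lemma rad_quot_add0 : left_id rad_quot_zero rad_quot_add.
Proof. by elim/quotW=> x; rewrite !piE add0r. Qed.
Lemma rad_quot_addN : left_inverse rad_quot_zero rad_quot_opp rad_quot_add.
Proof. by elim/quotW=> x; rewrite !piE addNr. Qed.

HB.instance Definition _ := GRing.isZmodule.Build rad_quot
  rad_quot_addA rad_quot_addC rad_quot_add0 rad_quot_addN.

Lemma rad_quot_mulA : associative rad_quot_mul.
Proof. by elim/quotW=> x; elim/quotW=> y; elim/quotW=> z; rewrite !piE mulrA. Qed.
Lemma rad_quot_mul1l : left_id rad_quot_one rad_quot_mul.
Proof. by elim/quotW=> x; rewrite !piE mul1r. Qed.
Lemma rad_quot_mul1r : right_id rad_quot_one rad_quot_mul.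
Proof. by elim/quotW=> x; rewrite !piE mulr1. Qed.
Lemma rad_quot_mulDl : left_distributive rad_quot_mul +%R.
Proof.
move=> + + +; elim/quotW=> x; elim/quotW=> y; elim/quotW=> z.
by rewrite -[+%R]/rad_quot_add !piE mulrDl.
Qed.
Lemma rad_quot_mulDr : right_distributive rad_quot_mul +%R.
Proof.
move=> + + +; elim/quotW=> x; elim/quotW=> y; elim/quotW=> z.
by rewrite -[+%R]/rad_quot_add !piE mulrDr.
Qed.

HB.instance Definition _ := GRing.Zmodule_isPzRing.Build rad_quot
  rad_quot_mulA rad_quot_mul1l rad_quot_mul1r rad_quot_mulDl rad_quot_mulDr.

Lemma pi_rad_zmod_morphism : zmod_morphism \pi_rad_quot.
Proof.
move=> x y; rewrite (pi_rad_add_subproof x (- y)).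
by rewrite (pi_rad_opp_subproof y).
Qed.
Lemma pi_rad_monoid_morphism : monoid_morphism \pi_rad_quot.
Proof.
split=> [|x y]; last exact: pi_rad_mul_subproof.
by rewrite -[1 in RHS]/rad_quot_one !piE.
Qed.

End RadicalIdeal.

Definition ideal_mul (R : pzRingType) (I J : set R) : set R :=
  [set x | exists s : seq (R * R),
    (forall p, p \in s -> I p.1 /\ J p.2) /\ x = \sum_(p <- s) p.1 * p.2].

Definition ideal_exp (R : pzRingType) (I : set R) (n : nat) : set R :=
  iter n (ideal_mul I) setT.

Definition nilpotent_ideal (R : pzRingType) (I : set R) : Prop :=
  exists n, (1 <= n)%N /\ ideal_exp I n = [set 0].

Definition semilocal (R : pzRingType) : Prop := semisimple_ring (rad_quot R).

Definition semiprimary (R : pzRingType) : Prop :=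
  semilocal R /\ nilpotent_ideal (rad R).

(* Restriction of scalars of a right S-module along f : R -> S. *)
Definition restrict_scalars (R S : pzRingType) (f : {rmorphism R -> S})
  (M : lmodType S^c) : Type := M.

Section RestrictScalars.
Context (R S : pzRingType) (f : {rmorphism R -> S}) (M : lmodType S^c).

HB.instance Definition _ := GRing.Zmodule.on (restrict_scalars f M).

Definition restrict_scale (a : R^c) (m : restrict_scalars f M) :
  restrict_scalars f M := (f a : S^c) *: (m : M).

Lemma restrict_scaleA a b m :
  restrict_scale a (restrict_scale b m) = restrict_scale (a * b) m.
Proof.
rewrite /restrict_scale scalerA; congr (_ *: _).
exact: (esym (rmorphM f b a)).
Qed.
Lemma restrict_scale1 : left_id 1 restrict_scale.
Proof. by move=> m; rewrite /restrict_scale (rmorph1 f) scale1r. Qed.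
Lemma restrict_scaleDr : right_distributive restrict_scale +%R.
Proof. by move=> a m n; rewrite /restrict_scale scalerDr. Qed.
Lemma restrict_scaleDl m : {morph restrict_scale^~ m : a b / a + b}.
Proof. by move=> a b; rewrite /restrict_scale (rmorphD f) scalerDl. Qed.

HB.instance Definition _ := GRing.Zmodule_isLmodule.Build R^c
  (restrict_scalars f M)
  restrict_scaleA restrict_scale1 restrict_scaleDr restrict_scaleDl.

End RestrictScalars.

(* Main.v *)
(* For B <= A in the Loewy series of M, the factor A / B is a module over the
   semisimple ring Q = E / rad E.  If it satisfies one of the chain conditions
   over L = Lambda, then so does Q / ann (A / B), which embeds into a finite
   power of A / B; conversely A / B is a finitely generated quotient of it.  So
   everything reduces to Q-L-bimodule subfactors of Q, which have finite length as
   bimodules because Q has finite length on the left.  A simple Q-L-bimodule X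
   with a simple L-submodule T is the sum of the simple modules q T, hence has
   finite length over L as soon as it contains no infinite direct sum.  Under DCC
   such a T exists trivially.  Under ACC one follows Goldie: every essential right
   ideal of the image of L in End(X) contains an element acting bijectively on X,
   whose inverse lies in this image by ACC; so no proper right ideal is essential,
   and a complement of a maximal right ideal provides T. *)

Require Import Defs.
From HB Require Import structures.
From mathcomp Require Import all_boot all_order all_algebra.
From mathcomp Require Import all_classical.
Local Open Scope ring_scope.

Set Implicit Arguments.
Unset Strict Implicit.
Unset Printing Implicit Defensive.

Import GRing.Theory.
Local Open Scope classical_set_scope.
Local Notation rad := Defs.rad.

(** * Chain conditions on intervals of submodules *)

Lemma dependent_choice (T : Type) (P : T -> Prop) (R : T -> T -> Prop) (x0 : T) :
  P x0 -> (forall x, P x -> exists y, P y /\ R x y) ->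
  exists s : nat -> T,
    [/\ s 0%N = x0, forall n, P (s n) & forall n, R (s n) (s n.+1)].
Proof.
move=> Px0 step.
have next (u : {x | P x}) : {v : {x | P x} | R (sval u) (sval v)}.
  apply: cid; have [y [Py Ruy]] := step _ (svalP u).
  by exists (exist _ y Py).
pose s n := iter n (fun u => sval (next u)) (exist _ x0 Px0).
exists (fun n => sval (s n)); split=> // n; first exact: svalP.
exact: (svalP (next (s n))).
Qed.

Section Submodules.
Context (R : pzRingType) (V : lmodType R).
Implicit Types (N A B C : set V).

Lemma submoduleP N : submodule N <->
  [/\ N 0, forall x y, N x -> N y -> N (x + y) & forall a x, N x -> N (a *: x)].
Proof.
split=> [[N0 Nl]|[N0 ND NZ]].
  have {}N0 : N 0 by move: N0; rewrite inE.
  split=> // [x y Nx Ny|a x Nx].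
    by have := Nl 1 x y; rewrite scale1r !inE; apply.
  by have := Nl a x 0; rewrite addr0 !inE; apply.
split; first by rewrite inE.
by move=> a u v; rewrite !inE => Nu Nv; apply: ND => //; apply: NZ.
Qed.

Lemma submod0 N : submodule N -> N 0.
Proof. by case/submoduleP. Qed.

Lemma submodD N x y : submodule N -> N x -> N y -> N (x + y).
Proof. by case/submoduleP=> _ + _; apply. Qed.

Lemma submodZ N a x : submodule N -> N x -> N (a *: x).
Proof. by case/submoduleP=> _ _; apply. Qed.

Lemma submodN N x : submodule N -> N x -> N (- x).
Proof. by move=> sN Nx; rewrite -scaleN1r; apply: submodZ. Qed.

Lemma submodB N x y : submodule N -> N x -> N y -> N (x - y).
Proof. by move=> sN Nx Ny; apply: submodD => //; apply: submodN. Qed.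

Lemma submod_addl N x y : submodule N -> N x -> N (x + y) -> N y.
Proof. by move=> sN Nx Nxy; rewrite -(addKr x y) addrC; apply: submodB. Qed.

Lemma submodT : submodule [set: V].
Proof. by apply/submoduleP. Qed.

Lemma submod1 : submodule [set 0 : V].
Proof.
apply/submoduleP; split=> [//|x y -> ->|a x ->] /=; first by rewrite addr0.
by rewrite scaler0.
Qed.

Lemma submodI N A : submodule N -> submodule A -> submodule (N `&` A).
Proof.
move=> /submoduleP[N0 ND NZ] /submoduleP[A0 AD AZ]; apply/submoduleP.
by split=> [//|x y [Nx Ax] [Ny Ay]|a x [Nx Ax]]; split; auto.
Qed.

Lemma submod_bigcap (P : set (set V)) : (forall N, P N -> submodule N) ->
  submodule (\bigcap_(N in P) N).
Proof.
move=> sP; apply/submoduleP; split=> [N PN|x y Ix Iy N PN|a x Ix N PN].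
- exact: submod0 (sP _ PN).
- exact: submodD (sP _ PN) (Ix _ PN) (Iy _ PN).
- exact: submodZ (sP _ PN) (Ix _ PN).
Qed.

Definition sumset A B : set V := [set x + y | x in A & y in B].

Lemma submod_sum A B : submodule A -> submodule B -> submodule (sumset A B).
Proof.
move=> /submoduleP[A0 AD AZ] /submoduleP[B0 BD BZ]; apply/submoduleP; split.
- by exists 0 => //; exists 0; rewrite // addr0.
- move=> _ _ [x Ax [y By <-]] [x' Ax' [y' By' <-]].
  by exists (x + x'); [auto|exists (y + y'); [auto|rewrite addrACA]].
- move=> a _ [x Ax [y By <-]].
  by exists (a *: x); [auto|exists (a *: y); [auto|rewrite scalerDr]].
Qed.

Lemma sumset_subl A B : submodule B -> A `<=` sumset A B.
Proof. by move=> /submod0 B0 x Ax; exists x => //; exists 0; rewrite // addr0. Qed.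

Lemma sumset_subr A B : submodule A -> B `<=` sumset A B.
Proof. by move=> /submod0 A0 x Bx; exists 0 => //; exists x; rewrite // add0r. Qed.

Lemma sumset_sub A B C :
  submodule C -> A `<=` C -> B `<=` C -> sumset A B `<=` C.
Proof. by move=> sC AC BC _ [x /AC ? [y /BC ? <-]]; apply: submodD. Qed.

Lemma submod_bigcup (N : nat -> set V) :
  (forall i, submodule (N i)) -> (forall i, N i `<=` N i.+1) ->
  submodule (\bigcup_i N i).
Proof.
move=> sN inc.
have mono i j : (i <= j)%N -> N i `<=` N j.
  move=> /subnK <-; elim: (j - i)%N => [//|k IH]; rewrite addSn.
  exact: subset_trans (inc _).
apply/submoduleP; split.
- by exists 0%N => //; apply: submod0.
- move=> x y [i _ Nx] [j _ Ny]; exists (maxn i j) => //.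
  by apply: submodD => //; [apply: mono Nx|apply: mono Ny];
    rewrite ?leq_maxl ?leq_maxr.
- by move=> a x [i _ Nx]; exists i => //; apply: submodZ.
Qed.

(** The interval from [B] to [A] stands for the submodule lattice of [A / B], so that no quotient
    module has to be formed. *)
Definition between B A N := [/\ submodule N, B `<=` N & N `<=` A].

(** [true] selects the ascending and [false] the descending order, which lets one argument serve
    both chain conditions. *)
Definition directed_sub (b : bool) (X Y : set V) :=
  if b then X `<=` Y else Y `<=` X.

Definition chain_cond (b : bool) B A := forall N : nat -> set V,
  (forall i, between B A (N i)) -> (forall i, directed_sub b (N i) (N i.+1)) ->
  exists n, forall m, (n <= m)%N -> N m = N n.

Definition finite_length B A := forall b, chain_cond b B A.

Lemma chain_cond_noetherian :
  noetherian V <-> chain_cond true [set 0] [set: V].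
Proof.
split=> [h N hN|h N hN]; first by apply: h => i; have [] := hN i.
by apply: h => i; split=> // _ ->; apply: submod0.
Qed.

Lemma chain_cond_artinian : artinian V <-> chain_cond false [set 0] [set: V].
Proof.
split=> [h N hN|h N hN]; first by apply: h => i; have [] := hN i.
by apply: h => i; split=> // _ ->; apply: submod0.
Qed.

Lemma directed_sub_trans b X Y Z :
  directed_sub b X Y -> directed_sub b Y Z -> directed_sub b X Z.
Proof. by case: b => /= XY YZ; [apply: subset_trans YZ|apply: subset_trans XY]. Qed.

Lemma directed_sub_mono b (N : nat -> set V) :
  (forall i, directed_sub b (N i) (N i.+1)) ->
  forall i j, (i <= j)%N -> directed_sub b (N i) (N j).
Proof.
move=> inc i j /subnK <-; elim: (j - i)%N => [|k IH]; first by case: b {inc}.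
by rewrite addSn; apply: directed_sub_trans (inc _).
Qed.

Lemma chain_cond_max b B A (P : set (set V)) N0 :
  chain_cond b B A -> (forall N, P N -> between B A N) -> P N0 ->
  exists N, P N /\ forall N', P N' -> directed_sub b N N' -> N' = N.
Proof.
move=> ccBA PBA PN0; apply: contrapT => noN.
have [|s [_ Ps inc]] := @dependent_choice _ P
    (fun N N' => directed_sub b N N' /\ N' <> N) N0 PN0.
  move=> N PN; apply: contrapT => noN'; apply: noN; exists N; split=> // N' PN'.
  by move=> NN'; apply: contrapT => neq; apply: noN'; exists N'.
have [|n stat] := ccBA s (fun i => PBA _ (Ps i)).
  by move=> i; have [] := inc i.
by have [_] := inc n; apply; apply: stat.
Qed.

Lemma chain_cond_sub b B A B' A' :
  B `<=` B' -> A' `<=` A -> chain_cond b B A -> chain_cond b B' A'.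
Proof.
move=> BB' AA' h N hN; apply: h => i; have [sN BN NA] := hN i.
by split=> //; [apply: subset_trans BN|apply: subset_trans AA'].
Qed.

Lemma chain_cond_atom b B A :
  (forall N, between B A N -> N = B \/ N = A) -> chain_cond b B A.
Proof.
move=> atom N hN inc; pose e := if b then A else B.
have [[n Nn]|none] := pselect (exists n, N n = e); last first.
  exists 0%N => m _; have alt i : N i = if b then B else A.
    have [] := atom _ (hN i) => NE; move: none; rewrite /e; case: b {inc e} => //;
    by move=> [] ; exists i.
  by rewrite !alt.
exists n => m nm; rewrite Nn.
have := directed_sub_mono inc nm; rewrite Nn /e /directed_sub.
have [_ ? ?] := hN m.
by case: b {inc e Nn} => ?; apply/seteqP.
Qed.

(** The traces on [C] and the sums with [C] of a chain both become stationary, and comparable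
    submodules with equal traces and sums coincide by the modular law. *)
Lemma chain_cond_ext b B C A : submodule C -> B `<=` C -> C `<=` A ->
  chain_cond b B C -> chain_cond b C A -> submodule A -> chain_cond b B A.
Proof.
move=> sC BC CA ccBC ccCA sA N hN inc.
have [|i|n1 st1] := ccBC (fun i => N i `&` C).
- move=> i; have [sN BN NA] := hN i; split; first exact: submodI.
    by move=> x Bx; split; [apply: BN|apply: BC].
  by move=> x [].
- by have := inc i; case: b {ccBC ccCA inc} => /= NN x [Nx Cx]; split=> //; apply: NN.
have [|i|n2 st2] := ccCA (fun i => sumset (N i) C).
- move=> i; have [sN BN NA] := hN i; split; first exact: submod_sum.
    exact: sumset_subr.
  exact: sumset_sub.
- have := inc i; case: b {ccBC ccCA inc} => /= NN _ [x Nx [y Cy <-]];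
  by exists x; [apply: NN|exists y].
exists (maxn n1 n2) => m lem; set n := maxn n1 n2 in lem *.
have E1 : N m `&` C = N n `&` C.
  by rewrite !(st1 n, st1 m) // ?leq_maxl // (leq_trans _ lem) // leq_maxl.
have E2 : sumset (N m) C = sumset (N n) C.
  by rewrite !(st2 n, st2 m) // ?leq_maxr // (leq_trans _ lem) // leq_maxr.
have modular X Y : submodule X -> submodule Y -> X `<=` Y ->
    X `&` C = Y `&` C -> sumset X C = sumset Y C -> X = Y.
  move=> sX sY XY EI ES; apply/seteqP; split=> // y Yy.
  have : sumset X C y by rewrite ES; apply: sumset_subl.
  move=> [x Xx [c Cc yE]]; rewrite -yE; apply: submodD => //.
  have : (Y `&` C) c by split=> //; apply: (submod_addl sY (XY _ Xx)); rewrite yE.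
  by rewrite -EI => -[].
have [sNm _ _] := hN m; have [sNn _ _] := hN n.
have := directed_sub_mono inc lem; case: b {ccBC ccCA inc} => /= NN.
  by apply/esym/modular.
exact: modular.
Qed.

End Submodules.

(** A monotone injective map of intervals carries strict chains to strict chains. The base rings may
    differ, as in the passage between [M] and [Q]. *)
Lemma chain_cond_embed (R S : pzRingType) (V : lmodType R) (W : lmodType S) b
    (B A : set V) (B' A' : set W) (F : set V -> set W) :
  (forall N, between B A N -> between B' A' (F N)) ->
  (forall N N', N `<=` N' -> F N `<=` F N') ->
  (forall N N', between B A N -> between B A N' -> F N = F N' -> N = N') ->
  chain_cond b B' A' -> chain_cond b B A.
Proof.
move=> Fsub Fmono Finj cc N hN inc.
have [|i|n st] := cc (F \o N); first by move=> i; apply: Fsub.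
  by have := inc i; case: b {cc inc} => /=; apply: Fmono.
by exists n => m nm; apply: Finj => //; apply: st.
Qed.

(** * Sums, intersections and independent families *)

Section SumsAndIntersections.
Context (R : pzRingType) (V : lmodType R).
Implicit Types (N A B C X Y T U W : set V).

(** The factor [(Y + T) / Y] embeds into [T / B] by intersecting with [T]. *)
Lemma chain_cond_sum b B Y T : submodule B -> submodule Y -> submodule T ->
  B `<=` Y -> B `<=` T ->
  chain_cond b B Y -> chain_cond b B T -> chain_cond b B (sumset Y T).
Proof.
move=> sB sY sT BY BT ccY ccT.
apply: (chain_cond_ext sY) => //; [exact: sumset_subl| |exact: submod_sum].
apply: (@chain_cond_embed _ _ _ _ b _ _ B T (fun N => N `&` T)) ccT.
- move=> N [sN YN NYT]; split; first exact: submodI.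
    by move=> x Bx; split; [apply/YN/BY|apply: BT].
  by move=> x [].
- by move=> N N' NN' x [Nx Tx]; split=> //; apply: NN'.
suff le N N' : between Y (sumset Y T) N -> between Y (sumset Y T) N' ->
    N `&` T = N' `&` T -> N `<=` N'.
  by move=> N N' hN hN' E; apply/seteqP; split; apply: le.
move=> [sN YN NYT] [sN' YN' _] E x Nx; have [y Yy [t Tt xE]] := NYT _ Nx.
rewrite -xE; apply: submodD => //; first exact: YN'.
have : (N `&` T) t by split=> //; apply: (submod_addl sN (YN _ Yy)); rewrite xE.
by rewrite E => -[].
Qed.

(** Dually, [W] modulo its intersection with [U] embeds into [A / U] by adding [U]. *)
Lemma chain_cond_cap b U W A : submodule U -> submodule W -> submodule A ->
  U `<=` A -> W `<=` A ->
  chain_cond b U A -> chain_cond b W A -> chain_cond b (U `&` W) A.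
Proof.
move=> sU sW sA UA WA ccU ccW.
apply: (chain_cond_ext sW) => //.
apply: (@chain_cond_embed _ _ _ _ b _ _ U A (fun N => sumset U N)) ccU.
- move=> N [sN UWN NW]; split; first exact: submod_sum.
    exact: sumset_subl.
  by apply: sumset_sub => //; apply: subset_trans WA.
- by move=> N N' NN' _ [x Nx [u Uu <-]]; exists x => //; exists u => //; apply: NN'.
suff le N N' : between (U `&` W) W N -> between (U `&` W) W N' ->
    sumset U N = sumset U N' -> N `<=` N'.
  by move=> N N' hN hN' E; apply/seteqP; split; apply: le.
move=> [sN UWN NW] [sN' UWN' NW'] E x Nx.
have : sumset U N' x by rewrite -E; apply: sumset_subr.
move=> [u Uu [y N'y xE]]; rewrite -xE; apply: submodD => //.
apply: UWN'; split=> //; have -> : u = x - y by rewrite -xE addrK.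
by apply: submodB => //; [apply: NW|apply: NW'].
Qed.

(* Under ACC the partial sums, under DCC the tails of an infinite independent
   family of submodules give a contradiction. *)
Lemma no_independent_sequence b B A (Y T : nat -> set V) :
  submodule B -> chain_cond b B A ->
  (forall i, between B A (Y i)) -> (forall i, between B A (T i)) ->
  (forall i, Y i.+1 = sumset (Y i) (T i)) -> (forall i, Y i `&` T i `<=` B) ->
  (forall i, ~ (T i `<=` B)) -> False.
Proof.
move=> sB cc hY hT YE disj nT.
have YS i : Y i `<=` Y i.+1.
  by rewrite YE; apply: sumset_subl; have [] := hT i.
have TY i : T i `<=` Y i.+1.
  by rewrite YE; apply: sumset_subr; have [] := hY i.
case: b cc => cc.
  have [n st] := cc Y hY YS; apply: (nT n) => x Tx; apply: (disj n); split=> //.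
  by rewrite -(st n.+1) //; apply: TY.
(* [S k n] is the sum of [B] and the [T i] with k <= i < k + n; the tail of the family from [k] on
   is the union of these over [n]. *)
pose S k := fix S n := if n is n'.+1 then sumset (S n') (T (k + n')%N) else B.
have sS k n : submodule (S k n).
  by elim: n => [//|n IH]; apply: submod_sum => //; have [] := hT (k + n)%N.
have Sinc k n : S k n `<=` S k n.+1.
  by apply: sumset_subl; have [] := hT (k + n)%N.
have BS k n : B `<=` S k n.
  by elim: n => [//|n IH]; apply: subset_trans (Sinc k n).
have SY k n : S k n `<=` Y (k + n)%N.
  elim: n => [|n IH] /=; first by rewrite addn0; have [] := hY k.
  rewrite addnS; apply: sumset_sub; [by have [] := hY (k + n).+1| |exact: TY].
  by apply: subset_trans (YS _).
have SA k n : S k n `<=` A by apply: subset_trans (@SY k n) _; have [] := hY (k + n)%N.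
have Sdisj k n : Y k `&` S k n `<=` B.
  elim: n => [x []//|n IH] x [Yx [s Ss [t Tt xE]]]; apply: IH; split=> //.
  suff Bt : B t by rewrite -xE; apply: submodD => //; apply: BS.
  apply: (disj (k + n)%N); split=> //; have [sY _ _] := hY (k + n)%N.
  apply: (submod_addl sY (SY _ _ _ Ss)); rewrite xE.
  have := @directed_sub_mono _ _ true Y YS k (k + n)%N (leq_addr _ _).
  exact.
have Sshift k n : S k.+1 n `<=` S k n.+1.
  elim: n => [|n IH]; first exact: BS.
  apply: sumset_sub => //; first exact: subset_trans (Sinc _ _).
  by rewrite addSnnS; exact: (sumset_subr (sS k n.+1)).
have [|k|n st] := cc (fun k => \bigcup_n S k n).
- move=> k; split; first by apply: submod_bigcup => n; [apply: sS|apply: Sinc].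
    by move=> x Bx; exists 0%N.
  by move=> x [n _ /SA].
- by move=> x [n _ Sx]; exists n.+1 => //; apply: Sshift.
(* Once two consecutive tails agree, [T n] lies in the tail from [n.+1] on, which meets [Y n.+1]
   only inside [B]. *)
apply: (nT n) => x Tx; have : (\bigcup_j S n.+1 j) x.
  rewrite st //; exists 1%N => //; by rewrite /= addn0; exact: (sumset_subr sB).
by move=> [j _ Sx]; apply: (Sdisj n.+1 j); split=> //; apply: TY.
Qed.

End SumsAndIntersections.

(** * Semisimple rings *)

Lemma noetherian_max (R : pzRingType) (V : lmodType R) (P : set (set V)) N0 :
  noetherian V -> (forall N, P N -> submodule N) -> P N0 ->
  exists N, P N /\ forall N', P N' -> N `<=` N' -> N' = N.
Proof.
move=> /chain_cond_noetherian noe sP PN0.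
have [N PN|N [PN max]] := chain_cond_max noe _ PN0; last first.
  by exists N; split=> // N' PN'; apply: max.
have sN := sP _ PN; split=> // _ ->; exact: submod0.
Qed.

Lemma artinian_min (R : pzRingType) (V : lmodType R) (P : set (set V)) N0 :
  artinian V -> (forall N, P N -> submodule N) -> P N0 ->
  exists N, P N /\ forall N', P N' -> N' `<=` N -> N' = N.
Proof.
move=> /chain_cond_artinian art sP PN0.
have [N PN|N [PN max]] := chain_cond_max art _ PN0; last first.
  by exists N; split=> // N' PN'; apply: max.
have sN := sP _ PN; split=> // _ ->; exact: submod0.
Qed.

Lemma noetherian_cyclic (R : pzRingType) (V : lmodType R) :
  (forall N : set V, submodule N -> exists g, N g /\
     forall N', submodule N' -> N' g -> N `<=` N') -> noetherian V.
Proof.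
move=> cyc N sN inc; have [g [[n _ Ng] min]] := cyc _ (submod_bigcup sN inc).
exists n => m nm; have NnU : \bigcup_i N i `<=` N n by apply: min.
apply/seteqP; split; first by move=> x Nx; apply: NnU; exists m.
exact: (@directed_sub_mono _ _ true N inc).
Qed.

Notation right_ideal K := (@submodule _ (right_regular _) K).
Notation left_ideal K := (@submodule _ (_^o) K).

Lemma left_idealP (Q : pzRingType) (L : set Q) : left_ideal L <->
  [/\ L 0, forall x y, L x -> L y -> L (x + y) & forall a x, L x -> L (a * x)].
Proof. exact: submoduleP. Qed.

Section SemisimpleRing.
Context (Q : pzRingType) (ssQ : semisimple_ring Q).

(** Split 1 = e + p along [K] and a complement [P]: for [x] in [K] the element x - e x = p x lies in
    both and vanishes. *)
Lemma right_ideal_idempotent (K : set Q) : right_ideal K ->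
  exists e, K e /\ forall x, K x -> e * x = x.
Proof.
move=> sK; have [P [sP KP KPT]] := ssQ sK.
have /right_idealP[_ _ KM] := sK; have /right_idealP[_ _ PM] := sP.
have : [set x + y | x in K & y in P] (1 : Q) by rewrite KPT.
move=> [e Ke [p Pp ep]]; exists e; split=> // x Kx; apply/esym/subr0_eq.
suff : (K `&` P) (x - e * x) by rewrite KP.
split; first by apply: (@submodB _ (right_regular Q)) => //; apply: KM.
have -> : x - e * x = (p : Q) * x; last exact: PM.
have {}ep : (e : Q) + p = 1 := ep.
by rewrite -{1}(mul1r x) -ep mulrDl [e * x + _]addrC addrK.
Qed.

Lemma semisimple_right_noetherian : noetherian (right_regular Q).
Proof.
apply: noetherian_cyclic => K sK; have [e [Ke eK]] := right_ideal_idempotent sK.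
exists e; split=> // N /right_idealP[_ _ NM] Ne x Kx.
by rewrite -(eK _ Kx); apply: NM.
Qed.

Lemma semisimple_von_neumann_regular (z : Q) : exists c, z * c * z = z.
Proof.
have [|e [[c _ <-] ez]] := @right_ideal_idempotent [set z * u | u in [set: Q]].
  apply/right_idealP; split.
  - by exists 0; rewrite // mulr0.
  - by move=> _ _ [u _ <-] [v _ <-]; exists (u + v); rewrite // mulrDr.
  - by move=> _ v [u _ <-]; exists (u * v); rewrite // mulrA.
by exists c; apply: ez; exists 1; rewrite // mulr1.
Qed.

(* Take an idempotent g of L with g Q maximal; for x in L the element
   z = x - x g is killed by g on the right, and z = z c z would make
   g + (1 - g) c z a larger idempotent of L unless z = 0. *)
Lemma left_ideal_idempotent (L : set Q) : left_ideal L ->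
  exists g, L g /\ forall x, L x -> x * g = x.
Proof.
move=> sL; have /left_idealP[L0 LD LM] := sL.
pose F (g : Q) : set Q := [set y | g * y = y].
have [| |_ [[g [Lg gg ->]] gmax]] := @noetherian_max _ (right_regular Q)
    [set K | exists g, [/\ L g, g * g = g & K = F g]] (F 0)
    semisimple_right_noetherian.
- move=> _ [g [_ _ ->]]; apply/right_idealP; split; rewrite /F /=.
  + exact: mulr0.
  + by move=> x y gx gy; rewrite mulrDr gx gy.
  + by move=> x y gx; rewrite mulrA gx.
- by exists 0; split=> //; rewrite mulr0.
exists g; split=> // x Lx; pose z := x - x * g.
have Lz : L z by apply: (@submodB _ Q^o) => //; apply: LM.
have zg : z * g = 0 by rewrite mulrBl -mulrA gg subrr.
have [c zcz] := semisimple_von_neumann_regular z.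
pose g' := g + (1 - g) * c * z.
have Lg' : L g' by apply: LD => //; apply: LM.
have gg' : g * g' = g.
  by rewrite /g' mulrDr gg !mulrA [g * (1 - g)]mulrBr mulr1 gg subrr !mul0r addr0.
have g'g : g' * g = g by rewrite /g' mulrDl gg -[_ * z * g]mulrA zg mulr0 addr0.
have zcz' : z * ((1 - g) * c * z) = z.
  by rewrite !mulrA [z * (1 - g)]mulrBr mulr1 zg subr0.
have g'g' : g' * g' = g'.
  rewrite {2}/g' mulrDr g'g; congr (_ + _).
  by rewrite {1}/g' mulrDl -[_ * z * _]mulrA zcz' !mulrA [g * (1 - g)]mulrBr
             mulr1 gg subrr !mul0r add0r.
have FE : F g' = F g.
  apply: gmax; first by exists g'.
  by move=> y /= <-; rewrite /F /= mulrA g'g.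
have : F g g' by rewrite -FE.
rewrite /F /= gg' => g'E.
have h0 : (1 - g) * c * z = 0 by apply: (addrI g); rewrite -/g' -g'E addr0.
by apply/esym/subr0_eq; rewrite -/z -zcz' h0 mulr0.
Qed.

Lemma semisimple_left_noetherian : noetherian (Q^o).
Proof.
apply: noetherian_cyclic => L sL; have [g [Lg Lgx]] := left_ideal_idempotent sL.
exists g; split=> // N /left_idealP[_ _ NM] Ng x Lx.
by rewrite -(Lgx _ Lx); apply: NM.
Qed.

(** Right annihilators turn the chain into an ascending chain of right ideals. Nothing is lost: a
    left ideal with right identity [g] consists exactly of the [x] with x (1 - g) = 0. *)
Lemma semisimple_left_artinian : artinian (Q^o).
Proof.
move=> N sN dec; pose r (L : set Q) : set Q := [set y | forall x, L x -> x * y = 0].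
have [i|i y ry x Nx|n st] := semisimple_right_noetherian (N := r \o N).
- apply/right_idealP; split=> /= [x _|u v ru rv x Nx|u v ru x Nx].
  + exact: mulr0.
  + by rewrite mulrDr ru // rv // addr0.
  + by rewrite mulrA ru // mul0r.
- by apply: ry; apply: dec.
exists n => m nm; apply/seteqP.
split; first exact: (@directed_sub_mono _ _ false N dec _ _ nm).
have [g [Ng gN]] := left_ideal_idempotent (sN m) => x Nx.
have : (r \o N) n (1 - g).
  by rewrite -(st m nm) => y Ny; rewrite mulrBr mulr1 gN // subrr.
move=> /(_ _ Nx) /eqP; rewrite mulrBr mulr1 subr_eq0 => /eqP ->.
by have /left_idealP[_ _] := sN m; apply.
Qed.

Lemma semisimple_right_artinian : artinian (right_regular Q).
Proof.
move=> N sN dec; pose l (K : set Q) : set Q := [set y | forall x, K x -> y * x = 0].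
have [i|i y ly x Nx|n st] := semisimple_left_noetherian (N := l \o N).
- apply/left_idealP; split=> /= [x _|u v lu lv x Nx|u v lv x Nx].
  + exact: mul0r.
  + by rewrite mulrDl lu // lv // addr0.
  + by rewrite -mulrA lv // mulr0.
- by apply: ly; apply: dec.
exists n => m nm; apply/seteqP.
split; first exact: (@directed_sub_mono _ _ false N dec _ _ nm).
have [e [Ne eN]] := right_ideal_idempotent (sN m) => x Nx.
have : (l \o N) n (1 - e).
  by rewrite -(st m nm) => y Ny; rewrite mulrBl mul1r eN // subrr.
move=> /(_ _ Nx) /eqP; rewrite mulrBl mul1r subr_eq0 => /eqP ->.
by have /right_idealP[_ _] := sN m; apply.
Qed.

End SemisimpleRing.

(** * Bimodule subfactors of a semisimple ring *)

Section Bimodules.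
Context (Q L : pzRingType) (f : {rmorphism L -> Q}).

Definition restricted_regular : lmodType L^c :=
  restrict_scalars f (right_regular Q).

Notation V := restricted_regular.
Notation Lsubmodule N := (@submodule _ V N).
Notation Lbetween B A N := (@between _ V B A N).

Lemma LsubmoduleP (N : set Q) : Lsubmodule N <->
  [/\ N 0, forall x y, N x -> N y -> N (x + y) & forall x a, N x -> N (x * f a)].
Proof.
split=> [/submoduleP[N0 ND NZ]|[N0 ND NZ]].
  by split=> // x a; apply: NZ.
by apply/submoduleP; split=> // a x; apply: NZ.
Qed.

Lemma Lsubmodule_mul_add (x : Q) (K N : set Q) : Lsubmodule K -> Lsubmodule N ->
  Lsubmodule [set u | exists k n, [/\ K k, N n & u = x * k + n]].
Proof.
move=> /LsubmoduleP[K0 KD Kf] /LsubmoduleP[N0 ND Nf]; apply/LsubmoduleP; split.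
- by exists 0, 0; rewrite mulr0 addr0.
- move=> _ _ [k [n [Kk Nn ->]]] [k' [n' [Kk' Nn' ->]]].
  by exists (k + k'), (n + n'); rewrite mulrDr addrACA; split; auto.
- move=> _ a [k [n [Kk Nn ->]]].
  by exists (k * f a), (n * f a); rewrite mulrDl mulrA; split; auto.
Qed.

Definition subbimodule (A : set Q) := left_ideal A /\ Lsubmodule A.

(** * Simple bimodules [C / A] *)

Section SimpleBimodule.
Implicit Types (B I K N T Y : set Q).
Context (ssQ : semisimple_ring Q) (A C : set Q).
Context (bA : subbimodule A) (bC : subbimodule C) (AC : A `<=` C).
Context (nCA : ~ (C `<=` A)).
Context (simpleCA : forall B, subbimodule B -> A `<=` B -> B `<=` C ->
  B = A \/ B = C).

(** * A simple [L]-submodule of [C / A] under ACC *)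

Section Noetherian.
Context (accCA : @chain_cond _ V true A C).
Context (g : Q) (Cg : C g) (gC : forall x, C x -> x * g = x).

Let A0 : A 0. Proof. by have [/left_idealP[? _ _] _] := bA. Qed.
Let AD x y : A x -> A y -> A (x + y).
Proof. by have [/left_idealP[_ h _] _] := bA; apply: h. Qed.
Let AM c x : A x -> A (c * x).
Proof. by have [/left_idealP[_ _ h] _] := bA; apply: h. Qed.
Let Af x a : A x -> A (x * f a).
Proof. by have [_ /LsubmoduleP[_ _ h]] := bA; apply: h. Qed.
Let AN x : A x -> A (- x).
Proof. by rewrite -mulN1r; apply: AM. Qed.
Let AB x y : A x -> A y -> A (x - y).
Proof. by move=> Ax Ay; apply: AD => //; apply: AN. Qed.
Let Aadd_l x y : A (x + y) -> A x -> A y.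
Proof. by move=> Axy Ax; rewrite -(addKr x y) addrC; apply: AB. Qed.
Let Asub_r x y : A (x - y) -> A y -> A x.
Proof. by move=> Axy Ay; rewrite -(subrK y x); apply: AD. Qed.
Let Asub_l x y : A (x - y) -> A x -> A y.
Proof. by move=> Axy Ax; rewrite -(subKr x y); apply: AB. Qed.
Let C0 : C 0. Proof. by have [/left_idealP[? _ _] _] := bC. Qed.
Let CD x y : C x -> C y -> C (x + y).
Proof. by have [/left_idealP[_ h _] _] := bC; apply: h. Qed.
Let CM c x : C x -> C (c * x).
Proof. by have [/left_idealP[_ _ h] _] := bC; apply: h. Qed.
Let Cf x a : C x -> C (x * f a).
Proof. by have [_ /LsubmoduleP[_ _ h]] := bC; apply: h. Qed.
Let CN x : C x -> C (- x).
Proof. by rewrite -mulN1r; apply: CM. Qed.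
Let CB x y : C x -> C y -> C (x - y).
Proof. by move=> Cx Cy; apply: CD => //; apply: CN. Qed.
Let sA : Lsubmodule A. Proof. by case: bA. Qed.

(* As g is a right identity of C, this is a ring with ideal A acting on C / A by
   right multiplication, and H / A is the image of L in End(C / A). *)
Let H : set Q := [set u | exists a a0, A a0 /\ u = g * f a + a0].

Let Hg : H g.
Proof. by exists 1, 0; rewrite rmorph1 mulr1 addr0. Qed.

Let AH : A `<=` H.
Proof. by move=> x Ax; exists 0, x; rewrite rmorph0 mulr0 add0r. Qed.

Let sH : Lsubmodule H.
Proof.
apply/LsubmoduleP; split; first exact: AH.
  move=> _ _ [a [x [Ax ->]]] [b [y [Ay ->]]]; exists (a + b), (x + y).
  by rewrite rmorphD mulrDr addrACA; split=> //; apply: AD.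
move=> _ b [a [x [Ax ->]]]; exists (a * b), (x * f b).
by rewrite rmorphM mulrDl mulrA; split=> //; apply: Af.
Qed.

Let HC : H `<=` C.
Proof. by move=> _ [a [x [Ax ->]]]; apply: CD; [apply: Cf|apply: AC]. Qed.

Let mul_mem (K : set Q) c u : Lsubmodule K -> A `<=` K -> C c -> K c -> H u ->
  K (c * u).
Proof.
move=> /LsubmoduleP[_ KD Kf] AK Cc Kc [a [x [Ax ->]]]; rewrite mulrDr mulrA gC //.
by apply: KD; [apply: Kf|apply/AK/AM].
Qed.

Let AHM x u : A x -> H u -> A (x * u).
Proof. by move=> Ax Hu; apply: mul_mem => //; apply: AC. Qed.

Let CHM c u : C c -> H u -> C (c * u).
Proof. by case: bC => _ sC Cc Hu; apply: mul_mem. Qed.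

Let KHM K k u : Lbetween A H K -> K k -> H u -> K (k * u).
Proof. by move=> [sK AK KH] Kk Hu; apply: mul_mem => //; apply/HC/KH. Qed.

Let bH : Lbetween A H H.
Proof. by split. Qed.

Let HHM u v : H u -> H v -> H (u * v).
Proof. by move=> Hu Hv; apply: (KHM bH). Qed.

Let gH u : H u -> A (g * u - u).
Proof.
move=> [a [x [Ax ->]]]; rewrite mulrDr mulrA gC // opprD addrACA subrr add0r.
by apply: AB => //; apply: AM.
Qed.

(** It suffices to test [u] on [g], since left multiplication by [g] is the identity on [H / A]. *)
Let faithful u : H u -> (forall c, C c -> A (c * u)) -> A u.
Proof. by move=> Hu Cu; apply: Asub_l (gH Hu) (Cu _ Cg). Qed.

Let ker (x : Q) : set Q := [set c | C c /\ A (c * x)].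

Let left_ideal_ker x : left_ideal (ker x).
Proof.
apply/left_idealP; split.
- by split; rewrite ?mul0r.
- by move=> c d [Cc Acx] [Cd Adx]; split; rewrite ?mulrDl; [apply: CD|apply: AD].
- by move=> a c [Cc Acx]; split; rewrite -?mulrA; [apply: CM|apply: AM].
Qed.

(* Right multiplication by x on C / A has the same kernel as its square. *)
Let fitting (x : Q) := forall c, C c -> A (c * x * x) -> A (c * x).

Let expH x k : H x -> C (g * x ^+ k).
Proof.
move=> Hx; elim: k => [|k IH]; first by rewrite mulr1.
by rewrite exprSr mulrA; apply: CHM.
Qed.

Let CHX c x k : C c -> H x -> C (c * x ^+ k).
Proof. by move=> Cc Hx; rewrite -(gC Cc) -mulrA; apply/CM/expH. Qed.

Let fitting_exp x c k : H x -> fitting x -> C c -> A (c * x ^+ k.+1) -> A (c * x).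
Proof.
move=> Hx fx Cc; elim: k => [//|k IH]; rewrite !exprSr !mulrA => Ac.
by apply: IH; rewrite exprSr mulrA; apply: fx => //; apply: CHX.
Qed.

(** Fitting's lemma, C = C x + ker x modulo [A]: the left ideals C x^k + A become stationary, so c
    x^(n+1) agrees modulo [A] with some d x^(n+2), and [fitting] cancels the surplus powers of
    [x]. *)
Let fitting_split x c : H x -> fitting x -> C c ->
  exists d, C d /\ A ((c - d * x) * x).
Proof.
move=> Hx fx Cc.
pose D k : set Q := [set y | exists d, C d /\ A (y - d * x ^+ k)].
have [k|k y [d [Cd Ay]]|n st] := @semisimple_left_artinian _ ssQ D.
- apply/left_idealP; split.
  + by exists 0; rewrite mul0r subr0.
  + move=> y z [d [Cd Ay]] [e [Ce Az]]; exists (d + e).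
    by rewrite mulrDl opprD addrACA; split; [apply: CD|apply: AD].
  + move=> a y [d [Cd Ay]]; exists (a * d).
    by rewrite -mulrA -mulrBr; split; [apply: CM|apply: AM].
- by exists (d * x); rewrite -mulrA -exprS; split=> //; apply: CHM.
have : D n.+1 (c * x ^+ n.+1) by exists c; rewrite subrr.
rewrite st ?leqnSn // -(st n.+2) ?(leqW (leqnSn n)) // => -[d [Cd Acd]].
exists d; split=> //.
apply: (@fitting_exp _ _ n) => //; first by apply: CB => //; apply: CHM.
by rewrite mulrBl -mulrA -exprS.
Qed.

(* The two-sided annihilator of y in C / A is a bimodule, so y H y is not in A;
   for y in K with maximal kernel and y h y not in A, the map h y is injective
   on (C y + A) / A and y h is the required element. *)
Let exists_fitting K : Lbetween A H K -> ~ (K `<=` A) ->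
  exists y, [/\ K y, ~ A y & fitting y].
Proof.
move=> bK nKA; have [sK AK KH] := bK.
have /existsNP[y0 /not_implyP[Ky0 nAy0]] := nKA.
have [||_ [[y [Ky nAy ->]] ymax]] := @noetherian_max _ Q^o
    [set D | exists y, [/\ K y, ~ A y & D = ker y]] (ker y0)
    (semisimple_left_noetherian ssQ).
- by move=> _ [y [_ _ ->]]; apply: left_ideal_ker.
- by exists y0.
have Hy := KH _ Ky.
have [h [Hh nAyhy]] : exists h, H h /\ ~ A (y * h * y).
  apply: contrapT => noh; apply: nAy.
  pose B : set Q := [set c | C c /\ forall h, H h -> A (c * h * y)].
  have [|||BE|BE] := @simpleCA B.
  - split.
      apply/left_idealP; split.
      + by split=> // h _; rewrite !mul0r.
      + move=> c d [Cc Bc] [Cd Bd]; split=> [|h Hh]; first exact: CD.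
        by rewrite !mulrDl; apply: AD; auto.
      + move=> a c [Cc Bc]; split=> [|h Hh]; first exact: CM.
        by rewrite -!mulrA; apply: AM; rewrite mulrA; apply: Bc.
    apply/LsubmoduleP; split.
    + by split=> // h _; rewrite !mul0r.
    + move=> c d [Cc Bc] [Cd Bd]; split=> [|h Hh]; first exact: CD.
      by rewrite !mulrDl; apply: AD; auto.
    + move=> c a [Cc Bc]; split=> [|h Hh]; first exact: Cf.
      have -> : c * f a * h * y = c * (g * f a * h) * y.
        by rewrite !mulrA gC.
      by apply/Bc/HHM => //; exists a, 0; rewrite addr0.
  - by move=> c Ac; split=> [|h Hh]; [apply: AC|do 2 apply: AHM => //].
  - by move=> c [].
  - rewrite -BE; split; first exact: HC.
    by move=> h Hh; apply: contrapT => nA; apply: noh; exists h.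
  have : B g by rewrite BE.
  move=> [_ /(_ g Hg)]; rewrite gC // => Agy; exact: Asub_l (gH Hy) Agy.
have Hyh : H (y * h) by apply: HHM.
have hy_inj c : C c -> A (c * y * h * y) -> A (c * y).
  move=> Cc Ac; suff : ker y c by case.
  rewrite -(ymax (ker (y * h * y))); first by split; rewrite ?mulrA.
    by exists (y * h * y); split=> //; apply: KHM => //; apply: KHM.
  by move=> d [Cd Ad]; split=> //; rewrite !mulrA; do 2 apply: AHM => //.
exists (y * h); split; first exact: KHM.
  by move=> Ayh; apply: nAyhy; apply: AHM.
(* A further factor [y] turns the assumption into c y h y h y in [A], from which h y is cancelled
   twice. *)
move=> c Cc; rewrite !mulrA => Ac; apply: AHM => //; apply: (hy_inj c) => //.
apply: hy_inj; first by do 2 apply: CHM => //.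
exact: AHM.
Qed.

Let essential (I : set Q) := Lbetween A H I /\
  forall K, Lbetween A H K -> ~ (K `<=` A) -> exists z, [/\ I z, K z & ~ A z].

(** Regularity concerns left multiplication by [x] on [H / A]; that right multiplication by [x] is
    then injective on [C / A] is a separate matter, settled by [regular_injective]. *)
Let right_regular_elt x := forall w, H w -> A (x * w) -> A w.

Let annihilator_between x I : Lbetween A H I -> H x ->
  Lbetween A H [set w | I w /\ A (x * w)].
Proof.
move=> [/LsubmoduleP[I0 ID If] AI IH] Hx; split; last by move=> w [/IH].
  apply/LsubmoduleP; split; first by split; rewrite ?mulr0.
    by move=> u v [Iu Au] [Iv Av]; split; rewrite ?mulrDr; auto.
  by move=> u a [Iu Au]; split; rewrite ?mulrA; auto.
by move=> w Aw; split; [apply: AI|apply: AM].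
Qed.

(* If y is a fitting element of the right annihilator of the fitting element x,
   then x + y is fitting with kernel ker x cap ker y. *)
Let essential_regular I : essential I -> exists x, I x /\ right_regular_elt x.
Proof.
move=> [bI essI]; have [sI AI IH] := bI.
have [| |_ [[x [Ix fx ->]] xmin]] := @artinian_min _ Q^o
    [set D | exists x, [/\ I x, fitting x & D = ker x]] (ker 0)
    (semisimple_left_artinian ssQ).
- by move=> _ [x [_ _ ->]]; apply: left_ideal_ker.
- by have I0 := AI _ A0; exists 0; split=> // c _; rewrite !mulr0.
have Hx := IH _ Ix; exists x; split=> // w Hw Axw; apply: contrapT => nAw.
(* If [x] has a non-zero right annihilator in [H / A], this annihilator meets [I] outside [A] by
   essentiality, which leaves room for [y]. *)
have [||y [[Iy Axy] nAy fy]] := @exists_fitting [set w | I w /\ A (x * w)].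
- exact: annihilator_between.
- have [||z [Iz [_ Axz] nAz] sub] := essI [set w | H w /\ A (x * w)].
  + exact: annihilator_between bH Hx.
  + by move=> /(_ w); apply: contra_not nAw; apply.
  + by apply: nAz; apply: sub.
have Hy := IH _ Iy.
have sumH : H (x + y) by apply: (@submodD _ V).
have Axyl e : A (e * x * y) by rewrite -mulrA; apply: AM.
(* As x y lies in [A], all terms containing x y drop out. A further factor [y] leaves c y^3, whence
   c y is in [A]; then only c x^2 remains. *)
have ker_sum c : C c -> A (c * (x + y) * (x + y)) -> A (c * x) /\ A (c * y).
  move=> Cc Axy2; have Acy : A (c * y).
    have : A (c * (x + y) * (x + y) * y) by apply: AHM.
    rewrite [c * (x + y) * (x + y)]mulrDr mulrDl => /Aadd_l/(_ (Axyl _)).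
    rewrite [c * (x + y)]mulrDr !mulrDl => /Aadd_l h.
    by apply: (fy c) => //; apply: (fy (c * y)); [apply: CHM|apply: h; apply: AHM].
  split=> //; apply: fx => //; move: Axy2.
  rewrite [c * (x + y)]mulrDr mulrDl addrC => /Aadd_l h.
  have {}h : A (c * x * (x + y)) by apply: h; apply: AHM => //; apply: sumH.
  by move: h; rewrite mulrDr addrC => /Aadd_l/(_ (Axyl _)).
have kerE : ker (x + y) = ker x.
  apply: xmin.
    exists (x + y); split=> //; first exact: (@submodD _ V).
    by move=> c Cc /ker_sum[] // Ax Ay; rewrite mulrDr; apply: AD.
  move=> c [Cc Ac]; split=> //.
  by have [] := ker_sum c Cc (AHM Ac sumH).
(* By minimality [y] kills ker x, and it kills C x because x y is in [A]; together these make up [C]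
   modulo [A]. *)
apply: nAy; apply: faithful => // c Cc.
have [d [Cd Acd]] := fitting_split Hx fx Cc.
have [_] : ker (x + y) (c - d * x).
  by rewrite kerE; split=> //; apply: CB => //; apply: CHM.
rewrite mulrDr => /Aadd_l/(_ Acd); rewrite mulrBl => Acy.
exact: Asub_r Acy (Axyl d).
Qed.

Let essentialH : essential H.
Proof.
split=> // K [_ _ KH] /existsNP[z /not_implyP[Kz nAz]].
by exists z; split=> //; apply: KH.
Qed.

Let essentialI I J : essential I -> essential J -> essential (I `&` J).
Proof.
move=> [[sI AI IH] eI] [[sJ AJ JH] eJ]; split.
  split; first exact: (@submodI _ V).
    by move=> x Ax; split; [apply: AI|apply: AJ].
  by move=> x [/IH].
move=> K [sK AK KH] nKA; have [z [Iz Kz nAz]] := eI _ (And3 sK AK KH) nKA.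
have [||y [Jy [Iy Ky] nAy]] := eJ (I `&` K).
- split; first exact: (@submodI _ V).
    by move=> x Ax; split; [apply: AI|apply: AK].
  by move=> x [/IH].
- by move=> sub; apply: nAz; apply: sub.
by exists y.
Qed.

(** Either u K lies in [A], and then [K] itself lies in the preimage, or u K + A meets [I] outside
    [A]. *)
Let essential_preim u I : essential I -> H u ->
  essential [set h | H h /\ I (u * h)].
Proof.
move=> [[sI AI IH] eI] Hu; have /LsubmoduleP[I0 ID If] := sI.
have /LsubmoduleP[H0 HD Hf] := sH; split.
  split; last by move=> h [].
    apply/LsubmoduleP; split; first by split; rewrite ?mulr0.
      by move=> x y [Hx Ix] [Hy Iy]; split; rewrite ?mulrDr; auto.
    by move=> x a [Hx Ix]; split; rewrite ?mulrA; auto.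
  by move=> h Ah; split; [apply: AH|apply/AI/AM].
move=> K [sK AK KH] nKA; have /LsubmoduleP[K0 KD Kf] := sK.
have /existsNP[z /not_implyP[Kz nAz]] := nKA.
have [uKA|/existsNP[k /not_implyP[Kk nAuk]]] :=
    pselect (forall k, K k -> A (u * k)).
  by exists z; split=> //; split; [apply: KH|apply/AI/uKA].
pose N : set Q := [set v | exists k a, [/\ K k, A a & v = u * k + a]].
have [||v [Iv [k' [a [Kk' Aa vE]]] nAv]] := eI N.
- split.
  + exact: Lsubmodule_mul_add.
  + by move=> a Aa; exists 0, a; rewrite mulr0 add0r.
  + by move=> _ [k1 [a1 [K1 A1 ->]]]; apply: HD; [apply: HHM|]; auto.
- by move=> sub; apply: nAuk; apply: sub; exists k, 0; rewrite addr0.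
exists k'; split=> //.
  split; first exact: KH.
  have -> : u * k' = v - a by rewrite vE addrK.
  exact: (@submodB _ V) (AI _ Aa).
by move=> Ak'; apply: nAv; rewrite vE; apply: AD => //; apply: AM.
Qed.

(* If K meets x H + A in A only, then the sums K + x K + ... + x^n K ascend
   strictly. *)
Let essential_mul x : H x -> right_regular_elt x ->
  essential [set u | exists h a, [/\ H h, A a & u = x * h + a]].
Proof.
move=> Hx rx; have /LsubmoduleP[H0 HD Hf] := sH.
split.
  split.
  - exact: Lsubmodule_mul_add.
  - by move=> a Aa; exists 0, a; rewrite mulr0 add0r.
  - by move=> _ [k1 [a1 [K1 A1 ->]]]; apply: HD; [apply: HHM|]; auto.
move=> K [sK AK KH] nKA; apply: contrapT => disj; apply: nKA.
have /LsubmoduleP[K0 KD Kf] := sK.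
have {}disj z h a : K z -> H h -> A a -> z = x * h + a -> A z.
  move=> Kz Hh Aa zE; apply: contrapT => nAz; apply: disj.
  by exists z; split=> //; exists h, a.
(* Horner's scheme: [T n] is A + K + x K + ... + x^(n-1) K. *)
pose T := fix T n : set Q := if n is n'.+1
  then [set v | exists t k, [/\ T n' t, K k & v = x * t + k]] else A.
have bT n : Lbetween A H (T n).
  elim: n => [|n [sT AT TH]]; first by split.
  split.
  - exact: Lsubmodule_mul_add.
  - by move=> a Aa; exists 0, a; rewrite mulr0 add0r; split;
      [exact: submod0 sT|apply: AK|].
  - by move=> _ [t [k [Tt Kk ->]]]; apply: HD; [apply: HHM|]; auto.
have xT n t : T n t -> T n.+1 (x * t) by move=> Tt; exists t, 0; rewrite addr0.
have [|n|n st] := accCA (N := T).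
- by move=> n; have [sT AT TH] := bT n; split=> // y /TH/HC.
- elim: n => [|n IH] y; first by have [_ AT _] := bT 1%N; apply: AT.
  by move=> [t [k [Tt Kk ->]]]; exists t, k; split=> //; apply: IH.
move=> k Kk; have Tk j : T j.+1 (x ^+ j * k).
  elim: j => [|j IHj]; last by rewrite exprS -mulrA; apply: xT.
  by exists 0, k; rewrite mul1r mulr0 add0r.
(* From x^(m+1) k = x t + k', the element k' lies in both [K] and x H, hence in [A], and regularity
   of [x] shows that x^m k - t is in [A]. *)
have main m : T m (x ^+ m * k) -> A k.
  elim: m => [|m IH]; first by rewrite mul1r.
  move=> [t [k' [Tt Kk' E]]]; have [sT AT TH] := bT m.
  have Hd : H (x ^+ m * k - t).
    apply: (@submodB _ V) => //; last exact: TH.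
    by have [_ _] := bT m.+1; apply.
  have Ak' : A k'.
    apply: (disj _ _ 0 Kk' Hd) => //.
    by rewrite addr0 mulrBr mulrA -exprS E addrC addKr.
  apply: IH; have -> : x ^+ m * k = (x ^+ m * k - t) + t by rewrite subrK.
  apply: (@submodD _ V) => //; apply/AT/rx => //.
  by rewrite mulrBr mulrA -exprS E addrC addKr.
by apply: (main n); rewrite -(st n.+1).
Qed.

(* C / A is nonsingular: among the annihilators in C / A of essential right
   ideals there is a largest one, which is a bimodule. *)
Let regular_injective x c : H x -> right_regular_elt x -> C c -> A (c * x) -> A c.
Proof.
move=> Hx rx Cc Acx.
pose l (K : set Q) : set Q := [set d | C d /\ forall k, K k -> A (d * k)].
have lL K : left_ideal (l K).
  apply/left_idealP; split.
  - by split=> // k _; rewrite mul0r.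
  - move=> d e [Cd ld] [Ce le]; split=> [|k Kk]; first exact: CD.
    by rewrite mulrDl; apply: AD; auto.
  - move=> a d [Cd ld]; split=> [|k Kk]; first exact: CM.
    by rewrite -mulrA; apply: AM; auto.
have [||_ [[K [eK ->]] Kmax]] := @noetherian_max _ Q^o
    [set D | exists K, essential K /\ D = l K] (l H)
    (semisimple_left_noetherian ssQ).
- by move=> _ [K [_ ->]]; apply: lL.
- by exists H.
(* The annihilator of the essential intersection of [K] and [K'] contains those of both, so
   maximality makes [l K] contain every [l K']. *)
have lsub K' : essential K' -> l K' `<=` l K.
  move=> eK' d [Cd ld].
  rewrite -(Kmax (l (K `&` K'))); first by split=> // k [_ /ld].
    by exists (K `&` K'); split=> //; apply: essentialI.
  by move=> e [Ce le]; split=> // k [/le].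
have [[sK AK KH] essK] := eK.
have [|||lE|lE] := @simpleCA (l K).
- split; first exact: lL.
  have /left_idealP[l0 lD _] := lL K.
  apply/LsubmoduleP; split=> // d a [Cd ld].
  have Hga : H (g * f a) by exists a, 0; rewrite addr0.
  apply: (lsub _ (essential_preim eK Hga)); split; first exact: Cf.
  move=> h [Hh Kh]; have -> : d * f a * h = d * (g * f a * h) by rewrite !mulrA gC.
  exact: ld.
- by move=> a Aa; split=> [|k Kk]; [apply: AC|apply: AHM => //; apply: KH].
- by move=> d [].
- have : l K c.
    apply: (lsub _ (essential_mul Hx rx)); split=> // _ [h [a [Hh Aa ->]]].
    by rewrite mulrDr mulrA; apply: AD; [apply: AHM|apply: AM].
  by rewrite lE.
(* If [l K] is all of [C], it contains [g], so [K] lies in [A]; this is impossible for an essential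
   [K], as [H] is not contained in [A]. *)
have : l K g by rewrite lE.
move=> [_ gK]; have [|z [Kz _ nAz]] := essK H bH.
  by move=> HA; apply: nCA => d Cd; rewrite -(gC Cd); apply/AM/HA.
by case: nAz; apply: Asub_l (gH (KH _ Kz)) (gK _ Kz).
Qed.

(* A regular x of I has an inverse d in End(C / A), which lies in H since the
   chain of the submodules d^n H + A is stationary. *)
Let essential_full I : essential I -> I g.
Proof.
move=> eI; have [[sI AI IH] _] := eI; have [x [Ix rx]] := essential_regular eI.
have Hx := IH _ Ix; have inj c := @regular_injective x c Hx rx.
have [||d0 [Cd0 Ad0]] := @fitting_split x g Hx => //.
  by move=> c Cc; apply: inj; apply: CHM.
have {}Ad0 : A (g - d0 * x) by apply: inj Ad0; apply: CB => //; apply: CHM.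
have [d [Cd gd dx]] : exists d, [/\ C d, g * d = d & A (d * x - g)].
  exists (g * d0); split; [exact: CM|by rewrite mulrA gC|].
  by rewrite -opprB; apply: AN; have := AM g Ad0; rewrite mulrBr gC // mulrA.
have xd : A (x * d - g).
  apply: inj; first by apply: CB => //; apply: CM.
  have -> : (x * d - g) * x = x * (d * x - g) - (g * x - x).
    by rewrite mulrBl mulrBr mulrA (gC (HC Hx)) opprB addrA addrNK.
  by apply: AB; [apply: AM|apply: gH].
have Ad a : A a -> A (a * d).
  move=> Aa; apply: inj; first exact: CM.
  rewrite -mulrA; have -> : d * x = (d * x - g) + g by rewrite subrK.
  by rewrite mulrDr; apply: AD; [apply: AM|rewrite gC //; apply: AC].
have Cdn n c : C c -> C (d ^+ n * c) by move=> Cc; apply: CM.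
pose W n : set Q := [set v | exists h a, [/\ H h, A a & v = d ^+ n * h + a]].
have /LsubmoduleP[H0 HD Hf] := sH.
have [n|n|n st] := accCA (N := W).
- split.
  + exact: Lsubmodule_mul_add.
  + by move=> a Aa; exists 0, a; rewrite mulr0 add0r.
  + by move=> _ [h [a [Hh Aa ->]]]; apply: CD; [apply/CM/HC|apply: AC].
- move=> _ [h [a [Hh Aa ->]]]; pose u := d ^+ n * h; pose v := d ^+ n.+1 * (x * h).
  exists (x * h), (a + (u - v)); split; first exact: HHM.
    apply: AD => //; rewrite -opprB; apply: AN.
    have -> : v - u = d ^+ n * ((d * x - g) * h + (g * h - h)).
      by rewrite mulrBl addrA subrK mulrBr /v /u exprSr !mulrA.
    by apply/AM/AD; [apply: AHM|apply: gH].
  by rewrite addrCA -/v -/u [v + _]addrC subrK addrC.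
(* Stationarity writes d^(n+1) as d^n h modulo [A]; cancelling d^n by left multiplications with [x]
   gives d = g h modulo [A], an element of [H]. *)
have : W n.+1 (d ^+ n.+1 * g) by exists g, 0; rewrite addr0.
rewrite st ?leqnSn // => -[h [a [Hh Aa E]]].
have cancel m u : g * u = u -> (forall b, A b -> A (b * u)) ->
    A (d ^+ m * u) -> A u.
  move=> gu Au; elim: m => [|m ih] Adu; first by rewrite mul1r in Adu.
  apply: ih; have := AM x Adu.
  have -> : x * (d ^+ m.+1 * u) = (x * d - g) * d ^+ m * u + g * d ^+ m * u.
    by rewrite -mulrDl -mulrDl subrK exprS !mulrA.
  have gdm : g * d ^+ m * u = d ^+ m * u.
    by case: m {Adu} => [|k]; rewrite ?mulr1 ?mul1r // exprS mulrA gd.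
  rewrite gdm => /Aadd_l; apply; apply: Au.
  elim: m {Adu gdm} => [|m IHm]; first by rewrite mulr1.
  by rewrite exprSr mulrA; apply: Ad.
have Adh : A (d - g * h).
  apply: (cancel n).
  - by rewrite mulrBr gd mulrA gC.
  - move=> b Ab; rewrite mulrBr mulrA gC; last exact: AC.
    by apply: AB; [apply: Ad|apply: AHM].
  have -> : d ^+ n * (d - g * h) = a - d ^+ n * (g * h - h).
    rewrite mulrBr -exprSr -[d ^+ n.+1](gC (x := _)) ?E; last first.
      by rewrite exprSr; apply: CM.
    by rewrite mulrBr opprB addrCA addrA.
  by apply: AB => //; apply/AM/gH.
have Hd : H d.
  by rewrite -(subrK (g * h) d); apply: HD; [apply: AH|apply: HHM].
rewrite -(subKr (x * d) g); apply: (@submodB _ V) => //; last exact: AI.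
exact: KHM.
Qed.

(** Let [I] be maximal between [A] and [H] without [g]. It is not essential, so some [K] outside [A]
    meets it inside [A]. If [N] below [K] is not inside [A], then [N + I] contains [g], hence is
    [H], and the modular law gives [N = K]. *)
Lemma noetherian_atom : exists T, [/\ Lsubmodule T, A `<=` T, T `<=` C,
  ~ (T `<=` A) & forall N, Lbetween A T N -> N = A \/ N = T].
Proof.
have nAg : ~ A g by move=> Ag; apply: nCA => c Cc; rewrite -(gC Cc); apply: AM.
have [||I [[bI nIg] Imax]] := chain_cond_max (P := [set I | Lbetween A H I /\ ~ I g])
    (N0 := A) accCA.
- by move=> I [[sI AI IH] _]; split=> // x /IH/HC.
- by split=> //; split.
have [sI AI IH] := bI.
have : ~ essential I by move=> /essential_full.
move=> /not_andP[//|/existsNP[K /not_implyP[bK /not_implyP[nKA disj]]]].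
have [sK AK KH] := bK.
have KIA z : K z -> I z -> A z.
  by move=> Kz Iz; apply: contrapT => nAz; apply: disj; exists z.
exists K; split=> // [x /KH/HC //|N [sN AN' NK]].
have [NA|/existsNP[z /not_implyP[Nz nAz]]] := pselect (N `<=` A).
  by left; apply/seteqP.
right; apply/seteqP; split=> // k Kk.
have sJ : Lsubmodule (@sumset _ V N I) by apply: submod_sum.
have IJ : I `<=` @sumset _ V N I by apply: sumset_subr.
have [Jg|nJg] := pselect (@sumset _ V N I g).
  have : @sumset _ V N I k.
    have [a [x [Ax ->]]] := KH _ Kk; apply: (@submodD _ V) => //; last exact/IJ/AI.
    by have /LsubmoduleP[_ _] := sJ; apply.
  move=> [n Nn [i Ii nik]]; rewrite -nik; apply: (@submodD _ V) => //.
  apply/AN'/KIA => //.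
  by apply: (@submod_addl _ V _ _ _ sK (NK _ Nn)); rewrite nik.
case: nAz; apply: KIA; first exact: NK.
rewrite -(Imax (@sumset _ V N I)) //; first exact: sumset_subl.
split=> //; split=> //; first exact: (subset_trans AI IJ).
by apply: sumset_sub => // x /NK/KH.
Qed.

End Noetherian.
Lemma simple_bimodule_atom b : @chain_cond _ V b A C ->
  exists T, [/\ Lsubmodule T, A `<=` T, T `<=` C,
  ~ (T `<=` A) & forall N, Lbetween A T N -> N = A \/ N = T].
Proof.
have [lC sC] := bC; have [_ sA] := bA; case: b => ccCA.
  have [g [Cg gC]] := left_ideal_idempotent ssQ lC.
  exact: (noetherian_atom ccCA Cg gC).
have [||T [[[sT AT TC] nTA] Tmin]] := chain_cond_max
    (P := [set T | Lbetween A C T /\ ~ (T `<=` A)]) (N0 := C) ccCA.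
- by move=> T [].
- by split=> //; split.
exists T; split=> // N [sN AN NT].
have [NA|nNA] := pselect (N `<=` A); first by left; apply/seteqP.
by right; apply: Tmin => //; split=> //; split=> //; apply: subset_trans TC.
Qed.

(** Modulo [A] each q T + A is zero or simple, being an image of [T / A]. Adding such modules one at
    a time either ends in a [Y] of finite length containing all of them or yields an infinite
    independent family. *)
Lemma simple_bimodule_finite_length b :
  @chain_cond _ V b A C -> @finite_length _ V A C.
Proof.
move=> ccCA; have [lA sA] := bA; have [lC sC] := bC.
have /left_idealP[A0 AD AM] := lA; have /LsubmoduleP[_ _ Af] := sA.
have [T [sT AT TC nTA Tatom]] := simple_bimodule_atom ccCA.
have /LsubmoduleP[T0 TD Tf] := sT.
have /left_idealP[_ CD CM] := lC.
pose qT (q : Q) : set Q := [set u | exists t a, [/\ T t, A a & u = q * t + a]].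
have bqT q : Lbetween A C (qT q).
  split.
  - exact: Lsubmodule_mul_add.
  - by move=> a Aa; exists 0, a; rewrite mulr0 add0r.
  - by move=> _ [t [a [Tt Aa ->]]]; apply: CD; [apply/CM/TC|apply: AC].
have qTatom q N : Lbetween A (qT q) N -> N = A \/ N = qT q.
  move=> [sN AN NqT]; have /LsubmoduleP[N0 ND Nf] := sN.
  have [|TE|TE] := Tatom [set t | T t /\ N (q * t)].
  - split; last by move=> t [].
      apply/LsubmoduleP; split; first by split; rewrite ?mulr0.
        by move=> x y [Tx Nx] [Ty Ny]; split; rewrite ?mulrDr; auto.
      by move=> x a [Tx Nx]; split; rewrite ?mulrA; auto.
    by move=> a Aa; split; [apply: AT|apply/AN/AM].
  - left; apply/seteqP; split=> // x Nx.
    have [t [a [Tt Aa xE]]] := NqT _ Nx; rewrite xE; apply: AD => //; apply: AM.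
    rewrite -TE; split=> //; have -> : q * t = x - a by rewrite xE addrK.
    exact: (@submodB _ V) (AN _ Aa).
  - right; apply/seteqP; split=> // _ [t [a [Tt Aa ->]]].
    by apply: ND; [|apply: AN]; move: Tt; rewrite -TE => -[].
have [[Y [[sY AY YC] finY qTY]]|noY] := pselect (exists Y, [/\ Lbetween A C Y,
    @finite_length _ V A Y & forall q, qT q `<=` Y]).
  suff CY : C `<=` Y by move=> b'; apply: chain_cond_sub (finY b').
  have /LsubmoduleP[Y0 YD Yf] := sY.
  (* [Y] is only an [L]-submodule, but the elements of [C] whose left multiples all lie in [Y] form
     a subbimodule containing [T], hence equal to [C]. *)
  have [|||E|E] := @simpleCA [set c | C c /\ forall q, Y (q * c)].
  - split.
      apply/left_idealP; split.
      + by split=> [|q]; [apply: AC|rewrite mulr0].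
      + by move=> x y [Cx Yx] [Cy Yy]; split=> [|q]; rewrite ?mulrDr; auto.
      + by move=> a x [Cx Yx]; split=> [|q]; rewrite ?mulrA; auto.
    have /LsubmoduleP[_ _ Cf] := sC; apply/LsubmoduleP; split.
    + by split=> [|q]; [apply: AC|rewrite mulr0].
    + by move=> x y [Cx Yx] [Cy Yy]; split=> [|q]; rewrite ?mulrDr; auto.
    + by move=> x a [Cx Yx]; split=> [|q]; rewrite ?mulrA; auto.
  - by move=> a Aa; split=> [|q]; [apply: AC|apply/AY/AM].
  - by move=> c [].
  - case: nTA => t Tt; rewrite -E; split=> [|q]; first exact: TC.
    by apply: (qTY q); exists t, 0; rewrite addr0.
  - by rewrite -{1}E => c [_ /(_ 1)]; rewrite mul1r.
have [||s [_ Ps Rs]] := @dependent_choice _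
    (fun Y => Lbetween A C Y /\ @finite_length _ V A Y)
    (fun Y Y' => exists q, ~ (qT q `<=` Y) /\ Y' = @sumset _ V Y (qT q)) A.
- split; first by split.
  by move=> b'; apply: chain_cond_atom => N [_ AN NA]; left; apply/seteqP.
- move=> Y [[sY AY YC] finY].
  have [q nqTY] : exists q, ~ (qT q `<=` Y).
    by apply: contrapT => /forallNP h; apply: noY; exists Y; split=> // q;
      apply: contrapT; apply: h.
  have [sqT AqT qTC] := bqT q.
  exists (@sumset _ V Y (qT q)); split; last by exists q.
  split.
    split; first exact: submod_sum.
      by apply: (subset_trans AY); apply: sumset_subl.
    exact: sumset_sub.
  move=> b'; apply: chain_cond_sum => //.
  by apply: chain_cond_atom; apply: qTatom.
have [q hq] := choice Rs.
exfalso; have := @no_independent_sequence _ V b A C s (qT \o q) sA ccCA.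
apply=> [i|i|i|i|i] //=.
- by have [] := Ps i.
- by have [] := hq i.
- have [nsub _] := hq i; have [[sY AY YC] _] := Ps i; have [sqT AqT _] := bqT (q i).
  have [|E x|E x] := qTatom (q i) (s i `&` qT (q i)).
  + split; first exact: submodI.
      by move=> x Ax; split; [apply: AY|apply: AqT].
    by move=> x [].
  + by rewrite E.
  + by case: nsub; rewrite -E => y [].
- have [nsub _] := hq i; have [[sY AY YC] _] := Ps i.
  by apply: contra_not nsub => /subset_trans; apply.
Qed.

End SimpleBimodule.

(** The left chain conditions of [Q] give a maximal subbimodule [A] with [A / Z] of finite length
    and, if [A] is not [Q], a minimal [C] above it; then [C / A] is simple and [C] contradicts the
    choice of [A]. *)
Lemma bimodule_finite_length (ssQ : semisimple_ring Q) b (Z : set Q) :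
  subbimodule Z -> @chain_cond _ V b Z [set: Q] ->
  @finite_length _ V Z [set: Q].
Proof.
move=> bZ ccZ.
have [||A [[bA ZA finA] Amax]] := @noetherian_max _ Q^o
    [set A | [/\ subbimodule A, Z `<=` A & @finite_length _ V Z A]] Z
    (semisimple_left_noetherian ssQ).
- by move=> A [[]].
- by split=> // b'; apply: chain_cond_atom => N [_ ZN NZ]; left; apply/seteqP.
have [<- //|nAT] := pselect (A = [set: Q]).
have [||C [[bC AC nCA] Cmin]] := @artinian_min _ Q^o
    [set C | [/\ subbimodule C, A `<=` C & C <> A]] [set: Q]
    (semisimple_left_artinian ssQ).
- by move=> C [[]].
- split=> //; last exact/nesym.
  by split; apply: submodT.
exfalso; apply: (nCA); apply: Amax => //; split=> //; first exact: subset_trans AC.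
have finAC : @finite_length _ V A C.
  apply: (@simple_bimodule_finite_length ssQ A C _ _ _ _ _ b) => //.
  - by move=> CA; apply: nCA; apply/seteqP.
  - move=> B bB AB BC; have [->|nBA] := pselect (B = A); first by left.
    by right; apply: Cmin.
  - exact: chain_cond_sub ccZ.
have [_ sA] := bA; have [_ sC] := bC.
by move=> b'; apply: (chain_cond_ext sA).
Qed.

Lemma right_ideal_submodule (K : set Q) : right_ideal K -> Lsubmodule K.
Proof.
move=> /right_idealP[K0 KD KM]; apply/LsubmoduleP; split=> // x a; exact: KM.
Qed.

(* By DCC on right ideals of Q the intersection is a finite one. *)
Lemma chain_cond_bigcap (ssQ : semisimple_ring Q) b (P : set (set Q)) :
  (forall U, P U -> right_ideal U /\ @chain_cond _ V b U [set: Q]) ->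
  @chain_cond _ V b (\bigcap_(U in P) U) [set: Q].
Proof.
move=> hP; set I := \bigcap_(U in P) U.
have [||U [[rU IU ccU] Umin]] := @artinian_min _ (right_regular Q)
    [set U | [/\ right_ideal U, I `<=` U & @chain_cond _ V b U [set: Q]]]
    [set: Q] (semisimple_right_artinian ssQ).
- by move=> U [].
- split=> //; first exact: submodT.
  by apply: chain_cond_atom => N [_ TN NT]; left; apply/seteqP.
suff -> : I = U by [].
apply/seteqP; split=> // q Uq W PW; have [rW ccW] := hP W PW.
rewrite -(Umin (U `&` W)) in Uq; [by case: Uq| |by move=> x []].
split; first exact: submodI.
  by move=> x Ix; split; [apply: IU|apply: Ix].
apply: (@chain_cond_cap _ V) => //; try exact: right_ideal_submodule.
exact: (@submodT _ V).
Qed.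

End Bimodules.

(** * Modules over a semiprimary ring *)

Definition rad_proj (E : pzRingType) : E -> rad_quot E :=
  (\pi_(rad_quot E))%qT.

HB.instance Definition _ (E : pzRingType) :=
  GRing.isZmodMorphism.Build E (rad_quot E) (@rad_proj E)
    (@pi_rad_zmod_morphism E).
HB.instance Definition _ (E : pzRingType) :=
  GRing.isMonoidMorphism.Build E (rad_quot E) (@rad_proj E)
    (@pi_rad_monoid_morphism E).

Lemma rad_proj_eqP (E : pzRingType) (x y : E) :
  rad_proj x = rad_proj y <-> rad E (x - y).
Proof. by split=> [/eqP/rad_quotP|/rad_quotP/eqP]. Qed.

Lemma rad_proj_surj (E : pzRingType) (q : rad_quot E) : exists x, rad_proj x = q.
Proof. by exists (repr q); rewrite /rad_proj reprK. Qed.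

(** * Factors [A / B] annihilated by the radical *)

Section SemisimpleFactor.
Context (E L : pzRingType) (f : {rmorphism L -> E}) (M : lmodType E^c).
Context (slE : semilocal E).

Notation Q := (rad_quot E).
Notation ML := (restrict_scalars f M).
Notation QL := (restricted_regular (@rad_proj E \o f)).
Notation "v .* e" := ((e : E^c) *: (v : M)) (at level 40).

Lemma submodule_restrict (N : set M) : submodule N -> @submodule _ ML N.
Proof.
move=> /submoduleP[N0 ND NZ]; apply/submoduleP; split=> // a x; exact: NZ.
Qed.

Context (B A : set M) (sB : submodule B) (sA : submodule A) (BA : B `<=` A).
Context (AJB : forall v x, A v -> rad E x -> B (v .* x)).

Notation pi := (@rad_proj E).

Let mulA (v : M) (x y : E) : v .* x .* y = v .* (x * y).
Proof. by rewrite scalerA. Qed.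

Let mulDr (v : M) (x y : E) : v .* (x + y) = v .* x + v .* y.
Proof. by rewrite -scalerDl. Qed.

Let mulBr (v : M) (x y : E) : v .* (x - y) = v .* x - v .* y.
Proof. by rewrite -scalerBl. Qed.

Let mul1 (v : M) : v .* 1 = v.
Proof. exact: scale1r. Qed.

(* The preimage of N under q |-> v q, for N containing B. *)
Definition transporter (N : set M) (v : M) : set Q :=
  [set q | exists x : E, rad_proj x = q /\ N (v .* x)].

(** Membership of v x in [N] depends only on the class of [x], since [A] times rad E lies in [B]. *)
Let transporterP N v x : @submodule _ ML N -> B `<=` N -> A v ->
  transporter N v (pi x) <-> N (v .* x).
Proof.
move=> sN BN Av; split=> [[y [/rad_proj_eqP yx Nvy]]|]; last by exists x.
have -> : v .* x = v .* y - v .* (y - x) by rewrite mulBr opprB addrCA subrr addr0.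
by apply: (submodB sN) => //; apply/BN/AJB.
Qed.

Let sB' : @submodule _ ML B. Proof. exact: submodule_restrict. Qed.

Lemma transporter_right_ideal N v : submodule N -> right_ideal (transporter N v).
Proof.
move=> /submoduleP[N0 ND NZ]; apply/right_idealP; split.
- by exists 0; rewrite scale0r raddf0.
- move=> _ _ [x [<- Nx]] [y [<- Ny]]; exists (x + y); rewrite raddfD mulDr.
  by split=> //; apply: ND.
- move=> _ q [x [<- Nx]]; have [y <-] := rad_proj_surj q; exists (x * y).
  by rewrite rmorphM -mulA; split=> //; apply: NZ.
Qed.

Lemma transporter_submodule N v : @submodule _ ML N ->
  @submodule _ QL (transporter N v).
Proof.
move=> /submoduleP[N0 ND NZ]; apply/LsubmoduleP; split.
- by exists 0; rewrite scale0r raddf0.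
- move=> _ _ [x [<- Nx]] [y [<- Ny]]; exists (x + y); rewrite raddfD mulDr.
  by split=> //; apply: ND.
- move=> _ a [x [<- Nx]]; exists (x * f a).
  by rewrite rmorphM -mulA; split=> //; apply: (NZ a).
Qed.

(** The map sending q to v q embeds [Q] modulo the annihilator of [v] into [A / B]; on submodules it
    sends [N] to v N + B. *)
Lemma transporter_chain_cond b v : A v -> @chain_cond _ ML b B A ->
  @chain_cond _ QL b (transporter B v) [set: Q].
Proof.
move=> Av; have /submoduleP[B0 BD BZ] := sB; have /submoduleP[A0 AD AZ] := sA.
pose F (N : set Q) : set M :=
  [set m | exists (x : E) y, [/\ N (pi x), B y & m = v .* x + y]].
apply: (@chain_cond_embed _ _ QL ML b (transporter B v) setT B A F).
- move=> N [/LsubmoduleP[N0 ND NM] BN _]; split.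
  + apply/submoduleP; split.
    * by exists 0, 0; rewrite scale0r addr0 raddf0.
    * move=> _ _ [x [y [Nx By ->]]] [x' [y' [Nx' By' ->]]].
      exists (x + x'), (y + y'); rewrite mulDr addrACA raddfD.
      by split=> //; [apply: ND|apply: BD].
    * move=> a _ [x [y [Nx By ->]]]; exists (x * f a), (y .* f a).
      rewrite rmorphM -mulA -scalerDr; split=> //; first exact: (NM _ a).
      exact: BZ.
  + by move=> y By; exists 0, y; rewrite scale0r add0r raddf0.
  + by move=> _ [x [y [Nx By ->]]]; apply: AD; [apply: AZ|apply: BA].
- by move=> N N' NN' _ [x [y [/NN' N'x By ->]]]; exists x, y.
suff le (N N' : set Q) : @between _ QL (transporter B v) setT N' ->
    F N = F N' -> N `<=` N'.
  by move=> N N' hN hN' FE; apply/seteqP; split; apply: le.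
move=> [sN' BN' _] FE q; have [x <-] := rad_proj_surj q => Nx.
have : F N' (v .* x) by rewrite -FE; exists x, 0; rewrite addr0.
move=> [x' [y [N'x' By xE]]].
have : N' (pi (x - x')).
  by apply/BN'/transporterP => //; rewrite mulBr xE addrC addKr.
by rewrite raddfB => h; rewrite -(subrK (pi x') (rad_proj x)); apply: (submodD sN').
Qed.

Let cyc (v : M) (K : set Q) : set M :=
  [set m | exists (x : E) y, [/\ K (pi x), B y & m = v .* x + y]].

Let cyc_submodule v K : right_ideal K -> submodule (cyc v K).
Proof.
move=> /right_idealP[K0 KD KM]; have /submoduleP[B0 BD BZ] := sB.
apply/submoduleP; split.
- by exists 0, 0; rewrite scale0r addr0 raddf0.
- move=> _ _ [x [y [Kx By ->]]] [x' [y' [Kx' By' ->]]].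
  exists (x + x'), (y + y'); rewrite mulDr addrACA raddfD.
  by split=> //; [apply: KD|apply: BD].
- move=> a _ [x [y [Kx By ->]]]; exists (x * a), (y .* a).
  by rewrite rmorphM -mulA -scalerDr; split=> //; [apply: KM|apply: BZ].
Qed.

Let B_cyc v K : right_ideal K -> B `<=` cyc v K.
Proof.
by move=> /right_idealP[K0 _ _] y By; exists 0, y; rewrite scale0r add0r raddf0.
Qed.

Let cyc_A v K : A v -> cyc v K `<=` A.
Proof.
have /submoduleP[A0 AD AZ] := sA => Av _ [x [y [_ By ->]]].
by apply: AD; [apply: AZ|apply: BA].
Qed.

Lemma cyclic_finite_length v : A v ->
  @finite_length _ QL (transporter B v) [set: Q] ->
  @finite_length _ ML B (cyc v setT).
Proof.
move=> Av fin b.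
apply: (@chain_cond_embed _ _ ML QL b _ _ _ _ (transporter^~ v)) (fin b) =>
  [N [sN BN _]|N N' NN'|].
- split=> //; first exact: transporter_submodule.
  by move=> _ [x [<- Bx]]; exists x; split=> //; apply: BN.
- by move=> _ [x [<- Nx]]; exists x; split=> //; apply: NN'.
suff le (N N' : set M) : @between _ ML B (cyc v setT) N ->
    @between _ ML B (cyc v setT) N' ->
    transporter N v = transporter N' v -> N `<=` N'.
  by move=> N N' hN hN' FE; apply/seteqP; split; apply: le.
move=> [sN BN Nv] [sN' BN' _] FE m Nm; have [x [y [_ By mE]]] := Nv _ Nm.
rewrite mE; apply: (submodD sN'); last exact: BN'.
apply/transporterP => //; rewrite -FE; apply/transporterP => //.
by apply: (submod_addl sN (BN _ By)); rewrite addrC -mE.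
Qed.

(** The annihilator of one [v] is in general only a right ideal, but the intersection over all [v]
    in [A] is two-sided and falls under the bimodule case. *)
Lemma annihilator_finite_length b : @chain_cond _ ML b B A ->
  forall v, A v -> @finite_length _ QL (transporter B v) [set: Q].
Proof.
move=> ccA; have /submoduleP[_ _ AZ] := sA.
pose P : set (set Q) := [set U | exists v, A v /\ U = transporter B v].
suff finI : @finite_length _ QL (\bigcap_(U in P) U) [set: Q].
  by move=> v Av b'; apply: chain_cond_sub (finI b') => // q; apply; exists v.
apply: (bimodule_finite_length slE (b := b)); last first.
  apply: chain_cond_bigcap => // _ [v [Av ->]].
  by split; [apply: transporter_right_ideal|apply: transporter_chain_cond].
have sI : @submodule _ QL (\bigcap_(U in P) U).
  apply: submod_bigcap => _ [v [_ ->]].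
  exact/right_ideal_submodule/transporter_right_ideal.
split=> //; have /LsubmoduleP[I0 ID _] := sI.
(* The product x y annihilates [v] as soon as [y] annihilates v x. *)
apply/left_idealP; split=> // q q' Iq _ [v [Av ->]]; move: Iq.
have [x <-] := rad_proj_surj q; have [y <-] := rad_proj_surj q' => Iy.
rewrite -rmorphM; apply/transporterP => //; rewrite -mulA.
apply/transporterP; [by []|by []|exact: AZ|].
by apply: Iy; exists (v .* x); split=> //; apply: AZ.
Qed.

(** Otherwise an infinite independent family arises: if [Y] of finite length misses [v],
    semisimplicity supplies a complement [K'] of the annihilator [K] of [v] modulo [Y], and v K' + B
    is the next member. *)
Lemma semisimple_factor_finite_length b : @chain_cond _ ML b B A ->
  @finite_length _ ML B A.
Proof.
move=> ccA.
have [[Y [[sY BY YA] finY AY]]|noY] := pselect (exists Y, [/\ between B A Y,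
    @finite_length _ ML B Y & A `<=` Y]).
  by move=> b'; apply: chain_cond_sub (finY b').
have [||s [_ Ps Rs]] := @dependent_choice _
    (fun Y => between B A Y /\ @finite_length _ ML B Y)
    (fun Y Y' => exists T, [/\ between B A T, Y' = sumset Y T,
      Y `&` T `<=` B & ~ (T `<=` B)]) B.
- split; first by split.
  by move=> b'; apply: chain_cond_atom => N [_ BN NB]; left; apply/seteqP.
- move=> Y [[sY BY YA] finY].
  have [v [Av nYv]] : exists v, A v /\ ~ Y v.
    apply: contrapT => nv; apply: noY; exists Y; split=> // v Av.
    by apply: contrapT => nYv; apply: nv; exists v.
  pose K := transporter Y v.
  have rK : right_ideal K by apply: transporter_right_ideal.
  have sY' := submodule_restrict sY.
  have KP x : K (pi x) <-> Y (v .* x) by apply: transporterP.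
  have [K' [rK' KK' KQ]] := slE rK.
  exists (sumset Y (cyc v K')); split.
    split.
      split; first by apply: submod_sum => //; apply: cyc_submodule.
        apply: subset_trans BY _; apply: sumset_subl; exact: cyc_submodule.
      by apply: sumset_sub => //; apply: cyc_A.
    move=> b'; apply: (@chain_cond_sum _ ML) => //.
    + by apply/submodule_restrict/cyc_submodule.
    + exact: B_cyc.
    have fin := cyclic_finite_length Av (annihilator_finite_length ccA Av).
    apply: (@chain_cond_sub _ ML) (fin b') => //.
    by move=> _ [x [y [_ By ->]]]; exists x, y.
  exists (cyc v K'); split=> //.
  + by split; [apply: cyc_submodule|apply: B_cyc|apply: cyc_A].
  + move=> m [Ym [x [y [K'x By mE]]]]; rewrite mE; apply: (submodD sB) => //.
    have Yvx : Y (v .* x).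
      by apply: (submod_addl sY (BY _ By)); rewrite addrC -mE.
    have : (K `&` K') (pi x) by split=> //; apply/KP.
    rewrite KK' => x0; apply: AJB => //; rewrite -[x]subr0.
    by apply/rad_proj_eqP; rewrite raddf0.
  + move=> cB; apply: nYv; have : [set x + y | x in K & y in K'] (1 : Q).
      by rewrite KQ.
    move=> [q Kq [q' K'q' qq']].
    have [x xq] := rad_proj_surj q; have [x' xq'] := rad_proj_surj q'.
    have Kx : K (pi x) by rewrite xq.
    have K'x' : K' (pi x') by rewrite xq'.
    have Yvx' : Y (v .* x').
      by apply/BY/cB; exists x', 0; rewrite addr0; split=> //; apply: submod0.
    rewrite -(mul1 v); apply/KP; rewrite rmorph1 -qq' -xq -xq' -raddfD.
    apply/KP; rewrite mulDr; apply: (submodD sY) => //; exact/KP.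
have [T hT] := choice Rs.
exfalso; apply: (@no_independent_sequence _ ML b B A s T) => // i.
- by have [[sY BY YA] _] := Ps i; split=> //; apply: submodule_restrict.
- by have [[sT BT TA] _ _ _] := hT i; split=> //; apply: submodule_restrict.
- by have [_ -> _ _] := hT i.
- by have [_ _ + _] := hT i.
- by have [_ _ _] := hT i.
Qed.

End SemisimpleFactor.

(* The Loewy series of the annihilators in M of the powers of rad E. *)
Definition socle_series (E : pzRingType) (M : lmodType E^c) (n : nat) : set M :=
  iter n (fun N => [set v | forall x : E, rad E x -> N ((x : E^c) *: v)]) [set 0].
Arguments socle_series {E} M n _.

Lemma socle_series_submodule (E : pzRingType) (M : lmodType E^c) n :
  submodule (socle_series M n).
Proof.
elim: n => [|n IH]; first exact: submod1.
apply/submoduleP; split=> [x _|u v su sv x rx|a v sv x rx].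
- by rewrite scaler0; apply: submod0 IH.
- by rewrite scalerDr; apply: submodD IH (su _ rx) (sv _ rx).
- by rewrite scalerA; apply: sv; apply: (radMl (a : E)).
Qed.

Lemma socle_series_incr (E : pzRingType) (M : lmodType E^c) n :
  socle_series M n `<=` socle_series M n.+1.
Proof. by move=> v sv x _; apply: submodZ => //; apply: socle_series_submodule. Qed.

(** Applied with the nilpotency exponent of rad E, this makes the series reach [M]. *)
Lemma socle_series_annihilator (E : pzRingType) (M : lmodType E^c) n (v : M) :
  (forall x, ideal_exp (rad E) n x -> (x : E^c) *: v = 0) -> socle_series M n v.
Proof.
elim: n v => [|n IH] v h; first by rewrite /= -(scale1r v); apply: h.
move=> x rx; apply: IH => y hy; rewrite scalerA; apply: (h ((x : E) * y)).
exists [:: (x, y)]; split; last by rewrite big_seq1.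
by move=> p; rewrite inE => /eqP ->.
Qed.

(** Induction along the Loewy series: each factor is annihilated by rad E and inherits the given
    chain condition, so it has finite length, and finite length passes to extensions. *)
Lemma semiprimary_finite_length (E L : pzRingType) (f : {rmorphism L -> E})
    (M : lmodType E^c) b : semiprimary E ->
  @chain_cond _ (restrict_scalars f M) b [set 0] [set: M] ->
  @finite_length _ (restrict_scalars f M) [set 0] [set: M].
Proof.
move=> [slE [n [_ Jn]]] ccM.
have <- : socle_series M n = setT.
  apply/seteqP; split=> // v _; apply: socle_series_annihilator => x.
  by rewrite Jn => ->; rewrite scale0r.
elim: n {Jn} => [|n IH] b'.
  by apply: chain_cond_atom => N [_ BN NA]; left; apply/seteqP.
have sS k := @socle_series_submodule E M k.
apply: (@chain_cond_ext _ (restrict_scalars f M) b' _ (socle_series M n)) => //.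
- exact: submodule_restrict.
- by move=> _ ->; exact: (submod0 (sS n)).
- exact: (@socle_series_incr E M n).
- have JS v x : socle_series M n.+1 v -> rad E x -> socle_series M n ((x : E^c) *: v).
    by apply.
  apply: (semisimple_factor_finite_length slE (sS n) (sS n.+1)
    (@socle_series_incr E M n) JS).
  by apply: chain_cond_sub ccM => // _ ->; exact: (submod0 (sS n)).
- exact: submodule_restrict.
Qed.

Theorem proposition2 (E : pzRingType) (hE : semiprimary E)
    (S : {pred E}) (Lambda : subPzRingType S) (M : lmodType E^c) :
  let M_Lambda : lmodType Lambda^c :=
    restrict_scalars (val : {rmorphism Lambda -> E}) M in
  noetherian M_Lambda <-> artinian M_Lambda.
Proof.
(* Either condition gives finite length, which comprises the other one. *)
move=> /=; split.
  by move=> /chain_cond_noetherian cc;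
    apply/chain_cond_artinian/(semiprimary_finite_length hE cc).
by move=> /chain_cond_artinian cc;
  apply/chain_cond_noetherian/(semiprimary_finite_length hE cc).
Qed.
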